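(* There are infinitely many combinatorially distinct $2$-simple, $2$-simplicial, facet-tangent convex $4$-polytopes.
   Context: A convex $4$-polytope $E$ is $2$-simplicial if all of its $2$-dimensional faces are triangles. It is $2$-simple if all $2$-dimensional faces of its dual polytope are triangles; equivalently, each edge of $E$ is contained in exactly three facets of $E$. A polytope $E\subset\mathbb{R}^4$ is facet-tangent if each of its facets ($3$-dimensional faces) is tangent to the unit sphere $S^3\subset\mathbb{R}^4$. Two polytopes are combinatorially distinct if their face lattices are not isomorphic. *)

(* Defs.v *)
From HB Require Import structures.
From mathcomp Require Import all_boot all_order all_algebra.
From mathcomp Require Import all_classical all_reals all_analysis.

Set Implicit Arguments.
Unset Strict Implicit.
Unset Printing Implicit Defensive.

Import Order.TTheory GRing.Theory Num.Theory.
Import numFieldNormedType.Exports.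

Local Open Scope classical_set_scope.
Local Open Scope ring_scope.

Section Polytopes.
Variables (R : realType) (n : nat).
Local Notation V := 'rV[R]_n.

Definition dotv (u v : V) : R := \sum_(i < n) u 0 i * v 0 i.

Definition conv_hull (S : set V) : set V :=
  smallest (fun A : set (convex_lmodType V) => convex_set A) S.

Definition aff_hull (S : set V) : set V :=
  [set y | exists m (x : 'I_m -> V) (a : 'I_m -> R),
     [/\ forall i, S (x i), \sum_i a i = 1 & y = \sum_i a i *: x i]].

(* Never holds for S = set0, so the empty face has no dimension here. *)
Definition has_dim (S : set V) (d : nat) : Prop :=
  exists (x : V) (U : {vspace V}),
    \dim U = d /\ aff_hull S = [set x + u | u in [set u | u \in U]].

Definition polytope (P : set V) : Prop :=
  exists2 S : set V, finite_set S & P = conv_hull S.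

(* The improper faces set0 (a = 0, b = 1) and P (a = 0, b = 0) are included. *)
Definition face (P F : set V) : Prop :=
  exists (a : V) (b : R),
    (forall x, P x -> dotv a x <= b) /\ F = P `&` [set x | dotv a x = b].

Definition kface (k : nat) (P F : set V) : Prop := face P F /\ has_dim F k.

Definition triangle (F : set V) : Prop :=
  has_dim F 2 /\ exists a b c : V, F = conv_hull [set a; b; c].

Definition two_simplicial (P : set V) : Prop :=
  forall F, kface 2 P F -> triangle F.

Definition polar (P : set V) : set V :=
  [set y | forall x, P x -> dotv x y <= 1].

(* The polar needs the origin in the interior, hence the translation by -c;
   up to combinatorial equivalence the result does not depend on c. *)
Definition dual_polytope (P D : set V) : Prop :=
  exists2 c : V, interior P c & D = polar [set x - c | x in P].

Definition two_simple (P : set V) : Prop :=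
  exists2 D : set V, dual_polytope P D & two_simplicial D.

Definition unit_sphere : set V := [set p | dotv p p = 1].

(* [set x | dotv p x = 1] is the hyperplane tangent to the unit sphere at p;
   the point of tangency must belong to F itself, not just to its affine hull. *)
Definition tangent_to_sphere (F : set V) : Prop :=
  exists p : V, [/\ unit_sphere p, F p & forall x, F x -> dotv p x = 1].

(* Meant for full-dimensional P, whose facets are the (n-1)-faces. *)
Definition facet_tangent (P : set V) : Prop :=
  forall F, kface n.-1 P F -> tangent_to_sphere F.

Definition face_lattice_iso (P Q : set V) : Prop :=
  exists f : set V -> set V, set_bij (face P) (face Q) f /\
    forall F G, face P F -> face P G -> (F `<=` G <-> f F `<=` f G).

End Polytopes.

(* Main.v *)
(* Eppstein, Kuperberg and Ziegler: let Q be a simplicial 4-polytope all of whose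
   edges are tangent to the unit sphere. Then the convex hull of Q and its polar is 2-simple and
   2-simplicial, and its facets are tangent to the sphere at the tangency points of
   the edges of Q. Infinitely many such Q arise from the 600-cell, scaled so that its
   edges are tangent: cutting off two opposite vertices leaves a block with two
   icosahedral facets, at which the dihedral angle in the Klein model of hyperbolic
   4-space is 72 degrees. As twice this is less than 180 degrees, translates of the
   block along an axis of hyperbolic space can be glued into convex chains of any length.
   In homogeneous coordinates the translation is a Lorentz transformation with entries
   in Z[phi], phi being the golden ratio, which reduces the convexity of the chain to
   finitely many inequalities in Z[phi] and a recurrence. *)
From HB Require Import structures.
Require Import Defs.
From Stdlib Require Import ZArith.
From mathcomp Require Import all_boot all_order all_algebra.
From mathcomp Require Import all_classical all_reals all_analysis.
From mathcomp Require Import finmap ring lra zify ssrZ.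
Set Implicit Arguments.
Unset Strict Implicit.
Unset Printing Implicit Defensive.
Import Order.TTheory GRing.Theory Num.Theory.
Import numFieldNormedType.Exports.
Local Delimit Scope Z_scope with ZZ.

(** * The 600-cell over Z[phi] *)

(** The polar of the hull is the intersection of Q with its own polar; the heart of the matter is
    that this intersection is the hull of the tangency points of the edges. Both polytopes are then
    known by generators and by inequalities, and no face lattice is ever computed: a 2-face lies in
    two facets, so it suffices that two facets share at most three vertices, in the hull and in its
    polar alike.

    The obstacle is the chain, which is nowhere built as a convex body. It is a list of tetrahedra
    with normals, of which only local and pairwise facts are known: every vertex lies below every
    facet plane, strictly unless it belongs to the facet; distinct vertices are joined by a segment
    that meets the ball; each triangle of a facet lies in a second facet. Maximizing a functional
    over the normals turns these facts into the statement that the cones over the facets cover the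
    space, with no topological argument. *)

(* [(a, b)] stands for [a + b * phi], phi being the golden ratio. *)
Definition zphi := (Z * Z)%type.

Definition zadd (a b : zphi) : zphi := (Z.add a.1 b.1, Z.add a.2 b.2).
Definition zopp (a : zphi) : zphi := (Z.opp a.1, Z.opp a.2).
Definition zmul (a b : zphi) : zphi :=
  (Z.add (Z.mul a.1 b.1) (Z.mul a.2 b.2),
   Z.add (Z.mul a.1 b.2) (Z.mul a.2 (Z.add b.1 b.2))).

(* Sound by the Fibonacci bounds 55/34 < phi < 34/21. *)
Definition zneg (lt : Z -> Z -> bool) (a : zphi) : bool :=
  lt (Z.add (Z.mul 34 a.1) (Z.mul 55 a.2)) Z0 &&
  lt (Z.add (Z.mul 21 a.1) (Z.mul 34 a.2)) Z0.
Definition zle0 := zneg Z.leb.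
Definition zlt0 := zneg Z.ltb.

Definition zvec := (zphi * zphi * zphi * zphi * zphi)%type.

Definition zsub a b := zadd a (zopp b).

(* In [zform], the sphere touched by the edges (of squared radius [2 + phi]) is the null
   cone, the vertices have norm [2 - phi] and two adjacent ones have product [phi - 2];
   [zaxis] is the restriction of the form to the plane moved by [zboost]. *)
Definition zaxis (X Y : zvec) : zphi :=
  let: (_, _, _, d, e) := X in let: (_, _, _, d', e') := Y in
  zsub (zmul d d') (zmul (2, 1)%ZZ (zmul e e')).
Definition zform (X Y : zvec) : zphi :=
  let: (a, b, c, _, _) := X in let: (a', b', c', _, _) := Y in
  zadd (zadd (zmul a a') (zadd (zmul b b') (zmul c c'))) (zaxis X Y).
(* The Lorentz transformation of the last two coordinates that maps the icosahedron of
   vertices adjacent to the south pole to the one adjacent to the north pole. *)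
Definition zboost (X : zvec) : zvec :=
  let: (a, b, c, d, e) := X in
  (a, b, c, zadd (zmul (3, 2)%ZZ d) (zmul (2, 6)%ZZ e),
   zadd (zmul (0, 2)%ZZ d) (zmul (3, 2)%ZZ e)).

Definition zflip (s : bool) (a : zphi) := if s then zopp a else a.
Definition zact (g : nat * (bool * bool * bool)) (X : zvec) : zvec :=
  let: (a, b, c, d, e) := X in let: (s, t, u) := g.2 in
  let: (a', b', c') := (zflip s a, zflip t b, zflip u c) in
  match g.1 with
  | 0 => (a', b', c', d, e)
  | 1 => (b', c', a', d, e)
  | _ => (c', a', b', d, e)
  end.
(** These 24 maps fix the last two coordinates, hence commute with [zboost] and fix both poles;
    facet checks need only run over orbit representatives. *)
Definition zsyms : seq (nat * (bool * bool * bool)) :=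
  [seq (c, s) | c <- [:: 0; 1; 2], s <-
    [seq (x, y) | x <- [seq (x, y) | x <- [:: true; false], y <- [:: true; false]], y <- [:: true; false]]].

(** Variants of [all] and [has] that stop at the first decisive element under call-by-value
    evaluation. *)
Fixpoint lall (T : Type) (p : pred T) (s : seq T) : bool :=
  if s is x :: s' then if p x then lall p s' else false else true.
Fixpoint lhas (T : Type) (p : pred T) (s : seq T) : bool :=
  if s is x :: s' then if p x then true else lhas p s' else false.

Definition zsigns (x : zphi) : seq zphi := undup [:: x; zopp x].
Definition even_perms (T : Type) (q : T * T * T * T) : seq (T * T * T * T) :=
  let: (a, b, c, d) := q in
  [:: (a, b, c, d); (b, c, a, d); (c, a, b, d); (b, a, d, c); (a, d, b, c); (d, b, a, c);
      (c, d, a, b); (d, a, c, b); (a, c, d, b); (d, c, b, a); (c, b, d, a); (b, d, c, a)].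

(* Scaled by 2, with last homogeneous coordinate 1. *)
Definition vertices600 : seq zvec := undup (flatten
  [seq let: (a, b, c, d) := p in
     [seq (x.1, x.2, y.1, y.2, (1, 0)%ZZ) |
        x <- [seq (a', b') | a' <- zsigns a, b' <- zsigns b],
        y <- [seq (c', d') | c' <- zsigns c, d' <- zsigns d]]
   | p <- flatten [seq even_perms q | q <-
       [:: ((2, 0), (0, 0), (0, 0), (0, 0)); ((1, 0), (1, 0), (1, 0), (1, 0));
           ((0, 1), (1, 0), (-1, 1), (0, 0))]%ZZ]]).

(** Each vertex comes with its neighbours further down the list, the candidates for continuing a
    clique through it; looking only ahead lists each clique once. *)
Fixpoint cone_points (s : seq zvec) : seq (zvec * seq zvec) :=
  if s is X :: s' then (X, [seq Y <- s' | zform X Y == (-2, 1)%ZZ]) :: cone_points s' else [::].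

(* Starting from the empty clique, each step appends a later common neighbour. *)
Definition cliques600 : seq (seq zvec) :=
  map fst (iter 4 (fun s => flatten
    [seq [seq (rcons c.1 a.1, a.2) | a <- cone_points c.2] | c <- s])
    [:: ([::], vertices600)]).

Definition zvadd (X Y : zvec) : zvec :=
  let: (a, b, c, d, e) := X in let: (a', b', c', d', e') := Y in
  (zadd a a', zadd b b', zadd c c', zadd d d', zadd e e').

(* Five times the sum of the vertices, with the last coordinate that makes it orthogonal
   to them: [5 * (4 + 6 * phi) / (2 + phi) = 6 + 8 * phi]. *)
Definition facet_normal (f : seq zvec) : zvec :=
  let: (a, b, c, d, _) := foldr zvadd ((0, 0), (0, 0), (0, 0), (0, 0), (0, 0))%ZZ f in
  (zmul (5, 0)%ZZ a, zmul (5, 0)%ZZ b, zmul (5, 0)%ZZ c, zmul (5, 0)%ZZ d, (6, 8)%ZZ).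

(* The normal lies in a fundamental domain of the signed cyclic permutations. *)
Definition reduced (f : seq zvec) : bool :=
  let: (a, b, c, _, _) := facet_normal f in
  all zle0 [:: zopp a; zopp b; zopp c; zsub b a; zsub c a].

Definition reduced_facets : seq (seq zvec) := [seq f <- cliques600 | reduced f].
Definition orbit_facets (reps : seq (seq zvec)) : seq (seq zvec) :=
  [seq map (zact g) f | g <- zsyms, f <- reps].

Definition south : zvec := ((0, 0), (0, 0), (0, 0), (-2, 0), (1, 0))%ZZ.
Definition north : zvec := ((0, 0), (0, 0), (0, 0), (2, 0), (1, 0))%ZZ.
Definition centre : zvec := ((0, 0), (0, 0), (0, 0), (0, 0), (1, 0))%ZZ.

(* [Y1] and [Y2] are the first two boosts of a vector; by the recurrence [raxis_boost2]
   the form with [X] then decreases along all further boosts. *)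
Definition decaying (X Y1 Y2 : zvec) : bool :=
  let h := zaxis X Y1 in zle0 h && zle0 (zsub (zaxis X Y2) h).

(* [if] rather than [&&] and [==>]: call-by-value evaluation is lazy only in branches. *)
Definition vertex_pair (X Y : zvec) : bool :=
  if (X == Y) || zle0 (zadd (zform X Y) (2, -1)%ZZ) then
    if (X == north) || (Y == south) then true else
    let Y1 := zboost Y in let Y2 := zboost Y1 in
    [&& (X == Y1) || zle0 (zadd (zform X Y1) (2, -1)%ZZ),
        zle0 (zadd (zform X Y2) (2, -1)%ZZ) & decaying X Y1 Y2]
  else false.

(* Positivity of the last coordinate of a vector, and of its boosts unless [b]. *)
Definition upward (b : bool) (X : zvec) : bool :=
  if zlt0 (zaxis centre X) then
    if b then true else
    let X1 := zboost X in zlt0 (zaxis centre X1) && decaying centre X1 (zboost X1)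
  else false.

(** The vertex is in the block of the facet, then in a later one (the vertex is boosted), then in an
    earlier one (the normal is boosted). The exceptions are orders that no chain realizes, as each
    pole occurs in one end block only; the membership alternatives are the vertices shared by glued
    blocks. *)
Definition facet_vertex (f : seq zvec) (W X : zvec) : bool :=
  if (if X \in f then zform X W == (0, 0)%ZZ else zlt0 (zform X W)) then
    if (if (north \in f) || (X == south) then true else
        let X1 := zboost X in let X2 := zboost X1 in
        [&& (X1 \in f) || zlt0 (zform W X1), zlt0 (zform W X2) & decaying W X1 X2]) then
      if (south \in f) || (X == north) then true else
      let W1 := zboost W in let W2 := zboost W1 in
      [&& (X \in map zboost f) || zlt0 (zform X W1), zlt0 (zform X W2) & decaying X W1 W2]
    else false
  else false.

Definition tetrahedron (verts f : seq zvec) : bool :=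
  [&& size f == 4, all (mem verts) f &
    all (fun k => all (fun l =>
      zform (nth south f k) (nth south f l) == if k == l then (2, -1)%ZZ else (-2, 1)%ZZ)
      (iota 0 4)) (iota 0 4)].

Definition shares (f g : seq zvec) (k : nat) : bool :=
  lall (fun l => if l == k then true else nth south f l \in g) (iota 0 4).

(** If [g] has a pole that [f] lacks, their common triangle lies in an icosahedron along which
    blocks are glued. Inside a chain [g] is cut off, and a facet [g'] of the adjacent block takes
    its place. *)
Definition neighbour (facets : seq (seq zvec)) (f : seq zvec) (k : nat) (g : seq zvec) : bool :=
  if shares f g k then
    if zlt0 (zform (nth south f k) (facet_normal g)) then
      if (if south \in g then
            if south \in f then true else
            lhas (fun g' => if shares (map zboost f) g' k then
              [&& south \notin g', north \notin g' &
                zlt0 (zform (zboost (nth south f k)) (facet_normal g'))] else false) facets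
          else true) then
        if north \in g then
          if north \in f then true else
          lhas (fun g' => if shares f (map zboost g') k then
            [&& south \notin g', north \notin g' &
              zlt0 (zform (nth south f k) (zboost (facet_normal g')))] else false) facets
        else true
      else false
    else false
  else false.

Lemma lallE (T : Type) (p : pred T) s : lall p s = all p s.
Proof. by elim: s => //= x s ->; case: (p x). Qed.

Lemma lhasE (T : Type) (p : pred T) s : lhas p s = has p s.
Proof. by elim: s => //= x s ->; case: (p x). Qed.

(** * The group of signed cyclic permutations and the invariance of the checks *)

Lemma zsymsP c s t u : ((c, (s, t, u)) \in zsyms) = (c < 3)%N.
Proof. by case: c s t u => [|[|[|c]]] [] [] []. Qed.

Lemma zoppK a : zopp (zopp a) = a.
Proof. by case: a => a b; rewrite /zopp /= !Z.opp_involutive. Qed.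

Lemma zflip_flip s t a : zflip s (zflip t a) = zflip (s (+) t) a.
Proof. by case: s t => [] [] //=; rewrite zoppK. Qed.

Lemma zact_comp g h : g \in zsyms -> h \in zsyms ->
  exists2 k, k \in zsyms & forall X, zact g (zact h X) = zact k X.
Proof.
case: g h => [c [[s t] u]] [c' [[s' t'] u']]; rewrite !zsymsP.
case: c' => [|[|[|//]]] c3 _.
- exists (c, (s (+) s', t (+) t', u (+) u')); first by rewrite zsymsP.
  by case: c c3 => [|[|[|//]]] _ [[[[x y] z] d] e]; rewrite /zact /= !zflip_flip.
- exists ((c.+1 %% 3)%N, (u (+) s', s (+) t', t (+) u')); first by rewrite zsymsP ltn_mod.
  by case: c c3 => [|[|[|//]]] _ [[[[x y] z] d] e]; rewrite /zact /= !zflip_flip.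
- exists ((c.+2 %% 3)%N, (t (+) s', u (+) t', s (+) u')); first by rewrite zsymsP ltn_mod.
  by case: c c3 => [|[|[|//]]] _ [[[[x y] z] d] e]; rewrite /zact /= !zflip_flip.
Qed.

Lemma zact_inv g : g \in zsyms -> exists2 k, k \in zsyms & cancel (zact k) (zact g) /\ cancel (zact g) (zact k).
Proof.
case: g => [c [[s t] u]]; rewrite zsymsP; case: c => [|[|[|//]]] _.
- exists (0, (s, t, u)); first by rewrite zsymsP.
  by split=> -[[[[x y] z] d] e]; rewrite /zact /= !zflip_flip !addbb.
- exists (2, (t, u, s)); first by rewrite zsymsP.
  by split=> -[[[[x y] z] d] e]; rewrite /zact /= !zflip_flip !addbb.
- exists (1, (u, s, t)); first by rewrite zsymsP.
  by split=> -[[[[x y] z] d] e]; rewrite /zact /= !zflip_flip !addbb.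
Qed.

Lemma zmul_flip s a b : zmul (zflip s a) (zflip s b) = zmul a b.
Proof.
case: s a b => [] [a a'] [b b'] //; rewrite /zmul /zopp /=.
by rewrite -Z.opp_add_distr !Z.mul_opp_opp.
Qed.

Lemma zmul_flipr s a b : zmul a (zflip s b) = zflip s (zmul a b).
Proof.
case: s a b => [] [a a'] [b b'] //; rewrite /zmul /zopp /=.
by rewrite -Z.opp_add_distr !Z.mul_opp_r -!Z.opp_add_distr.
Qed.

Lemma zadd_flip s a b : zadd (zflip s a) (zflip s b) = zflip s (zadd a b).
Proof. by case: s a b => [] [a a'] [b b'] //; rewrite /zadd /= /zopp /= !Z.opp_add_distr. Qed.

Section Symmetry.
Variable g : nat * (bool * bool * bool).
Hypothesis gsym : g \in zsyms.

Lemma zact_inj : injective (zact g).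
Proof. by have [k _ [_ h]] := zact_inv gsym; exact: can_inj h. Qed.

Lemma zact_boost X : zboost (zact g X) = zact g (zboost X).
Proof. by case: g gsym => [[|[|c]] [[s t] u]] _; case: X => [[[[x y] z] d] e]. Qed.

Lemma zaxis_act X Y : zaxis (zact g X) (zact g Y) = zaxis X Y.
Proof.
by case: g gsym => [[|[|c]] [[s t] u]] _; case: X Y => [[[[x y] z] d] e] [[[[x' y'] z'] d'] e'].
Qed.

Lemma zform_act X Y : zform (zact g X) (zact g Y) = zform X Y.
Proof.
have := zaxis_act X Y; case: X Y => [[[[x y] z] d] e] [[[[x' y'] z'] d'] e'].
case: g gsym => [[|[|c]] [[s t] u]] _ /= h; rewrite !zmul_flip //.
  by congr zadd; rewrite /zadd /=; congr pair; lia.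
by congr zadd; rewrite /zadd /=; congr pair; lia.
Qed.

Lemma zact_south : zact g south = south.
Proof. by case: g gsym => [[|[|[|c]]] [[[] []] []]]. Qed.

Lemma zact_north : zact g north = north.
Proof. by case: g gsym => [[|[|[|c]]] [[[] []] []]]. Qed.

Lemma zact_centre : zact g centre = centre.
Proof. by case: g gsym => [[|[|[|c]]] [[[] []] []]]. Qed.

Lemma facet_normal_act f : facet_normal (map (zact g) f) = zact g (facet_normal f).
Proof.
rewrite /facet_normal; set z0 := (X in foldr zvadd X).
have -> : foldr zvadd z0 (map (zact g) f) = zact g (foldr zvadd z0 f).
  elim: f => [|X f /= ->]; first by case: g gsym => [[|[|[|c]]] [[[] []] []]].
  case: X (foldr _ _ _) => [[[[x y] z] d] e] [[[[x' y'] z'] d'] e'].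
  by case: g gsym => [[|[|c]] [[s t] u]] _; rewrite /= !zadd_flip.
case: (foldr _ _ _) => [[[[x y] z] d] e].
by case: g gsym => [[|[|c]] [[s t] u]] _; rewrite /zact /= !zmul_flipr.
Qed.

Lemma mem_act X f : (zact g X \in map (zact g) f) = (X \in f).
Proof. exact/mem_map/zact_inj. Qed.

Lemma south_act f : (south \in map (zact g) f) = (south \in f).
Proof. by rewrite -{1}zact_south mem_act. Qed.

Lemma north_act f : (north \in map (zact g) f) = (north \in f).
Proof. by rewrite -{1}zact_north mem_act. Qed.

Lemma nth_act f k : nth south (map (zact g) f) k = zact g (nth south f k).
Proof.
have [kf|kf] := ltnP k (size f); first exact: nth_map.
by rewrite !nth_default ?size_map // zact_south.
Qed.

Lemma map_boost_act f : map zboost (map (zact g) f) = map (zact g) (map zboost f).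
Proof. by rewrite -!map_comp; apply: eq_map => X /=; rewrite zact_boost. Qed.

Lemma decaying_act X Y1 Y2 : decaying (zact g X) (zact g Y1) (zact g Y2) = decaying X Y1 Y2.
Proof. by rewrite /decaying !zaxis_act. Qed.

Lemma upward_act b X : upward b (zact g X) = upward b X.
Proof.
rewrite /upward !zact_boost.
by rewrite -[in LHS]zact_centre decaying_act !zaxis_act.
Qed.

Lemma facet_vertex_act f W X :
  facet_vertex (map (zact g) f) (zact g W) (zact g X) = facet_vertex f W X.
Proof.
rewrite /facet_vertex mem_act !zform_act south_act north_act.
have -> : (zact g X == south) = (X == south) by rewrite -{1}zact_south (inj_eq zact_inj).
have -> : (zact g X == north) = (X == north) by rewrite -{1}zact_north (inj_eq zact_inj).
rewrite !zact_boost map_boost_act.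
by rewrite !mem_act !zform_act !decaying_act.
Qed.

Lemma shares_act f f' k : shares (map (zact g) f) (map (zact g) f') k = shares f f' k.
Proof.
by rewrite /shares !lallE; apply: eq_all => l; rewrite nth_act mem_act.
Qed.

End Symmetry.

(** * Transport of the checks from orbit representatives to all facets *)

Section ChainData.
Variables (verts : seq zvec) (reps : seq (seq zvec)).
Let facets := orbit_facets reps.
Hypothesis zsyms_act_check : lall (fun g => lall (fun X => zact g X \in verts) verts) zsyms.
Hypothesis vertex_pair_check : lall (fun X => lall (vertex_pair X) verts) verts.
Hypothesis vertex_height_check : lall (fun X => upward (X == south) X) verts.
Hypothesis tetrahedron_check : lall (tetrahedron verts) reps.
Hypothesis normal_height_check :
  lall (fun f => upward (south \in f) (facet_normal f)) reps.
Hypothesis facet_vertex_check :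
  lall (fun f => let W := facet_normal f in lall (facet_vertex f W) verts) reps.
Hypothesis neighbour_check :
  lall (fun f => lall (fun k => lhas (neighbour facets f k) facets) (iota 0 4)) reps.

Lemma zact_vertices g X : g \in zsyms -> (zact g X \in verts) = (X \in verts).
Proof.
move=> gsym; have h k Y : k \in zsyms -> Y \in verts -> zact k Y \in verts.
  move=> ks Yv; have := zsyms_act_check; rewrite lallE => /allP/(_ _ ks).
  by rewrite lallE => /allP/(_ _ Yv).
apply/idP/idP => hX; last exact: (h g X gsym hX).
by have [k ks [_ gk]] := zact_inv gsym; have := h k _ ks hX; rewrite gk.
Qed.

Lemma tetrahedron_act g f : g \in zsyms -> tetrahedron verts (map (zact g) f) = tetrahedron verts f.
Proof.
move=> gsym; have h : all (preim (zact g) (mem verts)) f = all (mem verts) f.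
  by apply: eq_all => X; exact: zact_vertices.
rewrite /tetrahedron size_map all_map h; congr (_ && (_ && _)).
apply: eq_in_all => k _; apply: eq_in_all => l _.
by rewrite !(nth_act gsym) (zform_act gsym).
Qed.

Lemma orbit_facetsP f : reflect (exists g f0, [/\ g \in zsyms, f0 \in reps & f = map (zact g) f0])
  (f \in facets).
Proof.
apply: (iffP allpairsP) => [[[g f0] [/= gs fs ->]]|[g [f0 [gs fs ->]]]].
  by exists g, f0.
by exists (g, f0).
Qed.

Lemma facets_act g f : g \in zsyms -> f \in facets -> map (zact g) f \in facets.
Proof.
move=> gs /orbit_facetsP[h [f0 [hs fs ->]]]; have [k ks e] := zact_comp gs hs.
apply/orbit_facetsP; exists k, f0; split; [exact: ks|exact: fs|].
by rewrite -map_comp; apply: eq_map => X /=; rewrite e.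
Qed.

Lemma facets_tetrahedron f : f \in facets -> tetrahedron verts f.
Proof.
move=> /orbit_facetsP[g [f0 [gs fs ->]]]; rewrite tetrahedron_act //.
have := tetrahedron_check; rewrite lallE => /allP h; exact: (h _ fs).
Qed.

Lemma facets_height f : f \in facets -> upward (south \in f) (facet_normal f).
Proof.
move=> /orbit_facetsP[g [f0 [gs fs ->]]].
rewrite (south_act gs) (facet_normal_act gs) (upward_act gs).
by have := normal_height_check; rewrite lallE => /allP; exact.
Qed.

Lemma verts_height X : X \in verts -> upward (X == south) X.
Proof. by move=> Xv; have := vertex_height_check; rewrite lallE => /allP; exact. Qed.

Lemma verts_pair X Y : X \in verts -> Y \in verts -> vertex_pair X Y.
Proof.
move=> Xv Yv; have := vertex_pair_check; rewrite lallE => /allP h.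
have := h _ Xv; rewrite lallE => /allP h'; exact: (h' _ Yv).
Qed.

Lemma facets_vertex f X : f \in facets -> X \in verts ->
  facet_vertex f (facet_normal f) X.
Proof.
move=> /orbit_facetsP[g [f0 [gs fs ->]]] Xv; have [k ks [kK _]] := zact_inv gs.
rewrite -[X]kK (facet_normal_act gs) (facet_vertex_act gs).
have := facet_vertex_check; rewrite lallE => /allP h.
have := h _ fs; cbv zeta; rewrite lallE => /allP h'; apply: h'.
by rewrite zact_vertices.
Qed.

Lemma facets_neighbour f k : f \in facets -> (k < 4)%N -> exists g, [/\ g \in facets,
  shares f g k, zlt0 (zform (nth south f k) (facet_normal g)),
  south \in g -> south \notin f -> exists g', [/\ g' \in facets, south \notin g', north \notin g',
    shares (map zboost f) g' k & zlt0 (zform (zboost (nth south f k)) (facet_normal g'))] &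
  north \in g -> north \notin f -> exists g', [/\ g' \in facets, south \notin g', north \notin g',
    shares f (map zboost g') k & zlt0 (zform (nth south f k) (zboost (facet_normal g')))]].
Proof.
move=> /orbit_facetsP[h [f0 [hs fs ->]]] k4.
have := neighbour_check; rewrite lallE => /allP c.
have := c _ fs; rewrite lallE => {c}/allP c; have := c k.
rewrite mem_iota k4 lhasE => /(_ isT) /hasP[g gf].
rewrite /neighbour; case: ifP => // s1; case: ifP => // s2.
case: ifP => // s3 s4; exists (map (zact h) g); split.
- exact: (facets_act hs gf).
- by rewrite (shares_act hs).
- by rewrite (nth_act hs) (facet_normal_act hs) (zform_act hs).
- rewrite !(south_act hs) => sg /negPf sf; move: s3; rewrite sg sf lhasE => /hasP[g' gf'].
  case: ifP => // s5 /and3P[h1 h2 h3]; exists (map (zact h) g'); split.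
  + exact: (facets_act hs gf').
  + by rewrite (south_act hs).
  + by rewrite (north_act hs).
  + by rewrite map_boost_act // (shares_act hs).
  + by rewrite (nth_act hs) (facet_normal_act hs) (zact_boost hs) (zform_act hs).
- rewrite !(north_act hs) => sg /negPf sf; move: s4; rewrite sg sf lhasE => /hasP[g' gf'].
  case: ifP => // s5 /and3P[h1 h2 h3]; exists (map (zact h) g'); split.
  + exact: (facets_act hs gf').
  + by rewrite (south_act hs).
  + by rewrite (north_act hs).
  + by rewrite map_boost_act // (shares_act hs).
  + by rewrite (nth_act hs) (facet_normal_act hs) (zact_boost hs) (zform_act hs).
Qed.

End ChainData.

(** * The checks by computation *)

Lemma zsyms_act_check :
  lall (fun g => lall (fun X => zact g X \in vertices600) vertices600) zsyms.
Proof. by vm_compute. Qed.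

Lemma vertex_pair_check : lall (fun X => lall (vertex_pair X) vertices600) vertices600.
Proof. by vm_compute. Qed.

Lemma vertex_height_check : lall (fun X => upward (X == south) X) vertices600.
Proof. by vm_compute. Qed.

Lemma tetrahedron_check : lall (tetrahedron vertices600) reduced_facets.
Proof. by vm_compute. Qed.

Lemma normal_height_check :
  lall (fun f => upward (south \in f) (facet_normal f)) reduced_facets.
Proof. by vm_compute. Qed.

Lemma facet_vertex_check :
  lall (fun f => let W := facet_normal f in lall (facet_vertex f W) vertices600) reduced_facets.
Proof. by vm_compute. Qed.

Lemma neighbour_check :
  let facets := orbit_facets reduced_facets in
  lall (fun f => lall (fun k => lhas (neighbour facets f k) facets) (iota 0 4)) reduced_facets.
Proof. by vm_compute. Qed.

(* The copies of the first edge of such a facet are distinct, so the chains have unboundedly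
   many faces. *)
Definition free_edge (f : seq zvec) : bool :=
  [&& south \notin f, north \notin f,
    zlt0 (zform (nth south f 0) (zboost (nth south f 0))) &
    zlt0 (zform (nth south f 1) (zboost (nth south f 0)))].

Lemma free_edge_check : lhas free_edge (orbit_facets reduced_facets).
Proof. by vm_compute. Qed.

Local Open Scope classical_set_scope.
Local Open Scope ring_scope.

(** * Nonnegative combinations and faces *)

Section Dot.
Variables (R : realType) (n : nat).
Local Notation V := 'rV[R]_n.
Implicit Types x y z a : V.

Lemma dotvC x y : dotv x y = dotv y x.
Proof. by apply: eq_bigr => i _; rewrite mulrC. Qed.

Lemma dotvDl x y z : dotv (x + y) z = dotv x z + dotv y z.
Proof. by rewrite /dotv -big_split; apply: eq_bigr => i _; rewrite !mxE mulrDl. Qed.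

Lemma dotvZl c x z : dotv (c *: x) z = c * dotv x z.
Proof. by rewrite /dotv mulr_sumr; apply: eq_bigr => i _; rewrite !mxE mulrA. Qed.

Lemma dotvDr x y z : dotv z (x + y) = dotv z x + dotv z y.
Proof. by rewrite dotvC dotvDl !(dotvC z). Qed.

Lemma dotvZr c x z : dotv z (c *: x) = c * dotv z x.
Proof. by rewrite dotvC dotvZl dotvC. Qed.

Lemma dotvNl x z : dotv (- x) z = - dotv x z.
Proof. by rewrite -scaleN1r dotvZl mulN1r. Qed.

Lemma dotvNr x z : dotv z (- x) = - dotv z x.
Proof. by rewrite dotvC dotvNl dotvC. Qed.

Lemma dotv0l z : dotv 0 z = 0.
Proof. by rewrite -(scale0r 0) dotvZl mul0r. Qed.

Lemma dotv0r z : dotv z 0 = 0.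
Proof. by rewrite dotvC dotv0l. Qed.

Lemma dotv_suml (I : Type) (r : seq I) (P : pred I) (F : I -> V) z :
  dotv (\sum_(i <- r | P i) F i) z = \sum_(i <- r | P i) dotv (F i) z.
Proof.
elim/big_rec2: _ => [|i u v _ <-]; first exact: dotv0l.
by rewrite dotvDl.
Qed.

Lemma dotv_ge0 x : 0 <= dotv x x.
Proof. by apply: sumr_ge0 => i _; rewrite -expr2 sqr_ge0. Qed.

Lemma dotv_eq0 x : (dotv x x == 0) = (x == 0).
Proof.
apply/eqP/eqP => [|->]; last exact: dotv0l.
move=> h; apply/rowP => i; rewrite mxE.
have /psumr_eq0P h' : dotv x x = 0 by [].
have /eqP := h' (fun j _ => ltac:(by rewrite -expr2 sqr_ge0)) i isT.
by rewrite -expr2 sqrf_eq0 => /eqP.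
Qed.

Lemma dotv_gt0 x : x != 0 -> 0 < dotv x x.
Proof. by move=> x0; rewrite lt_neqAle dotv_ge0 eq_sym dotv_eq0 x0. Qed.

Lemma dotv_le x y : 2 * dotv x y <= dotv x x + dotv y y.
Proof.
have := dotv_ge0 (x - y); rewrite dotvDl !dotvDr !dotvNl !dotvNr (dotvC y x).
lra.
Qed.

Lemma dotv_inj x y : (forall z, dotv x z = dotv y z) -> x = y.
Proof.
move=> h; apply/eqP; rewrite -subr_eq0 -dotv_eq0; apply/eqP.
by rewrite dotvDl dotvNl h subrr.
Qed.

End Dot.

Section Comb.
Variables (R : realType) (n : nat).
Local Notation V := 'rV[R]_n.
Implicit Types (S : set V) (x y a : V).

(* [comb S m x]: x is a nonnegative combination of points of S with total weight m. *)
Inductive comb S : R -> V -> Prop :=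
| comb_nil : comb S 0 0
| comb_cons c y m x : 0 <= c -> S y -> comb S m x -> comb S (c + m) (c *: y + x).

Lemma comb_eq S m m' x x' : comb S m x -> m = m' -> x = x' -> comb S m' x'.
Proof. by move=> h <- <-. Qed.

Lemma comb_mem S x : S x -> comb S 1 x.
Proof.
move=> Sx; apply: (comb_eq (comb_cons ler01 Sx (comb_nil S))).
  by rewrite addr0.
by rewrite scale1r addr0.
Qed.

Lemma comb_ge0 S m x : comb S m x -> 0 <= m.
Proof. by elim=> // c y m' x' c0 _ _ ?; rewrite addr_ge0. Qed.

Lemma combD S m m' x x' : comb S m x -> comb S m' x' -> comb S (m + m') (x + x').
Proof.
move=> h h'; elim: h => [|c y k z c0 Sy _ IH]; first by rewrite !add0r.
by rewrite -!addrA; exact: comb_cons.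
Qed.

Lemma combZ S c m x : 0 <= c -> comb S m x -> comb S (c * m) (c *: x).
Proof.
move=> c0; elim=> [|d y k z d0 Sy _ IH].
  by rewrite mulr0 scaler0; exact: comb_nil.
by rewrite mulrDr scalerDr scalerA; apply: comb_cons => //; rewrite mulr_ge0.
Qed.

Lemma comb_trans S S' m x :
  (forall y, S y -> comb S' 1 y) -> comb S m x -> comb S' m x.
Proof.
move=> h; elim=> [|d y k z d0 Sy _ IH]; first exact: comb_nil.
by apply: combD => //; have := combZ d0 (h _ Sy); rewrite mulr1.
Qed.

Lemma comb_sub S S' m x : S `<=` S' -> comb S m x -> comb S' m x.
Proof. by move=> h; apply: comb_trans => y /h; exact: comb_mem. Qed.

Lemma comb_sum S (I : Type) (r : seq I) (P : pred I) (c : I -> R) (F : I -> V) :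
  (forall i, P i -> comb S (c i) (F i)) ->
  comb S (\sum_(i <- r | P i) c i) (\sum_(i <- r | P i) F i).
Proof.
move=> h; elim/big_rec2: _ => [|i u v Pi IH]; first exact: comb_nil.
by apply: combD => //; exact: h.
Qed.

Lemma comb_dot_le S m x a b :
  (forall y, S y -> dotv a y <= b) -> comb S m x -> dotv a x <= m * b.
Proof.
move=> h; elim=> [|d y k z d0 Sy _ IH]; first by rewrite dotv0r mul0r.
by rewrite dotvDr dotvZr mulrDl lerD// ler_wpM2l// h.
Qed.

Lemma comb_dot_eq S m x a b :
  (forall y, S y -> dotv a y = b) -> comb S m x -> dotv a x = m * b.
Proof.
move=> h; elim=> [|d y k z d0 Sy _ IH]; first by rewrite dotv0r mul0r.
by rewrite dotvDr dotvZr mulrDl IH h.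
Qed.

(** No generator exceeds [b], so a combination that reaches [m * b] uses only generators that attain
    it, apart from those with coefficient zero, which are dropped. *)
Lemma comb_face S m x a b : (forall y, S y -> dotv a y <= b) ->
  comb S m x -> dotv a x = m * b -> comb (S `&` [set y | dotv a y = b]) m x.
Proof.
move=> h; elim=> [|d y k z d0 Sy hz IH]; first by move=> _; exact: comb_nil.
rewrite dotvDr dotvZr mulrDl => e.
have hy := h _ Sy; have hz' := comb_dot_le h hz.
have hdy : d * dotv a y <= d * b by rewrite ler_wpM2l.
have ez : dotv a z = k * b by lra.
have ey : d * dotv a y = d * b by lra.
have [d00|dn0] := eqVneq d 0.
  by rewrite d00 scale0r !add0r; exact: IH.
apply: comb_cons => //; last exact: IH.
by split=> //; exact: (mulfI dn0).
Qed.

Lemma comb_exists S m x : comb S m x -> 0 < m -> exists y, S y.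
Proof. by elim=> [|c y *]; [rewrite ltxx | exists y]. Qed.

Lemma comb_one_convex S : convex_set (comb S 1 : set (convex_lmodType V)).
Proof.
move=> x y p; rewrite !in_setE => hx hy.
have p0 : 0 <= p%:num by [].
have p1 : 0 <= 1 - p%:num by rewrite subr_ge0.
apply: (comb_eq (combD (combZ p0 hx) (combZ p1 hy))); first by rewrite !mulr1 addrC subrK.
by [].
Qed.

Lemma comb_weight0 S m x : comb S m x -> m = 0 -> x = 0.
Proof.
elim=> // c y k z c0 _ /comb_ge0 k0 IH /eqP; rewrite paddr_eq0 // => /andP[/eqP -> /eqP /IH ->].
by rewrite scale0r addr0.
Qed.

Lemma convex_comb S (A : set (convex_lmodType V)) : convex_set A -> S `<=` A ->
  comb S 1 `<=` A.
Proof.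
(* The weight becomes a variable of the induction: for each positive weight [m] the claim is that
   [m^-1 *: x] lies in [A]. *)
move=> cA SA x hx; rewrite -[x]scale1r -[1]invr1.
move: hx (ltr01 : 0 < 1 :> R).
elim=> [|c y k z c0 Sy hz IH]; first by rewrite ltxx.
have [k0|k0] := eqVneq k 0 => ck.
  have z0 := comb_weight0 hz k0.
  have cn0 : c != 0 by move: ck; rewrite k0 addr0 => /lt0r_neq0.
  by rewrite k0 z0 !addr0 scalerA mulVf // scale1r; exact: SA.
have kp : 0 < k by rewrite lt_neqAle eq_sym k0 (comb_ge0 hz).
have p0 : 0 <= c / (c + k) by rewrite divr_ge0 // ltW.
have p1 : c / (c + k) <= 1 by rewrite ler_pdivrMr // mul1r lerDl ltW.
have := @cA y (k^-1 *: z) (Itv01 p0 p1).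
rewrite !in_setE => /(_ (SA _ Sy) (IH kp)).
congr (A _); rewrite /conv /= scalerDr !scalerA; congr (_ *: _ + _ *: _).
  exact: mulrC.
have ck0 : c + k != 0 by rewrite gt_eqF // ltr_wpDl.
rewrite /unstable.onem; field.
by rewrite ck0 k0.
Qed.

Lemma conv_hullE S : conv_hull S = comb S 1.
Proof.
apply/seteqP; split; last by move=> x hx A [cA SA]; exact: convex_comb hx.
by apply: smallest_sub; [exact: comb_one_convex | exact: comb_mem].
Qed.

End Comb.

(** * Separation of finitely generated cones and convex hulls *)

Section Farkas.
Variable R : realType.

(* Bartl's induction: if the functional [a] separates [y] from all the other
   generators, project everything along the last one onto the kernel of [a]. *)
Lemma farkas n (s : seq 'rV[R]_n) (y : 'rV[R]_n) :
  (forall a, (forall x, x \in s -> dotv a x <= 0) -> dotv a y <= 0) ->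
  exists m, comb [set` s] m y.
Proof.
move: {2}(size s) (erefl (size s)) => k; elim: k s y => [|k IH] [|z s] //= y.
  move=> _ h; have /eqP : dotv y y = 0 by apply/eqP; rewrite eq_le h // dotv_ge0.
  by rewrite dotv_eq0 => /eqP ->; exists 0; exact: comb_nil.
case=> sk h.
have [h'|] := pselect (forall a, (forall x, x \in s -> dotv a x <= 0) -> dotv a y <= 0).
  have [m hm] := IH s y sk h'; exists m; apply: comb_sub hm => x /=.
  by rewrite inE => ->; rewrite orbT.
move=> /existsNP[a0 /not_implyP[a0s /negP]]; rewrite -ltNge => a0y.
have a0z : 0 < dotv a0 z.
  rewrite ltNge; apply/negP => a0z.
  suff : dotv a0 y <= 0 by rewrite leNgt a0y.
  by apply: h => x; rewrite inE => /predU1P[->|/a0s].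
(* [p] projects along [z] onto the kernel of [a0]; by [pE], a functional of [p x] is a functional of
   [x] that vanishes at [z]. *)
pose p x := x - (dotv a0 x / dotv a0 z) *: z.
have pE b x : dotv b (p x) = dotv (b - (dotv b z / dotv a0 z) *: a0) x.
  rewrite /p dotvDl dotvDr dotvNl dotvNr !dotvZl dotvZr; field.
  by rewrite gt_eqF.
have [||m hm] := IH (map p s) (p y); first by rewrite size_map.
  move=> b hb; rewrite pE; apply: h => x; rewrite inE => /predU1P[->|xs].
    rewrite dotvDl dotvNl dotvZl divfK ?subrr ?gt_eqF //.
  by rewrite -pE; apply: hb; exact: map_f.
have [m' [x [hx xy xle]]] : exists m' x, [/\ comb [set` s] m' x, p y = p x & dotv a0 x <= 0].
  elim: hm => [|c _ {}m u c0 /mapP[v vs ->] _ [m' [x [hx -> xle]]]].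
    exists 0, 0; split; [exact: comb_nil | | by rewrite dotv0r].
    by rewrite /p dotv0r mul0r scale0r subr0.
  exists (c + m'), (c *: v + x); split; first exact: comb_cons.
    by apply/rowP => i; rewrite /p dotvDr dotvZr !mxE; ring.
  by rewrite dotvDr dotvZr; have := mulr_ge0_le0 c0 (a0s _ vs); lra.
(* Since [p y = p x], the vector [y - x] is a multiple of [z], and [d] is the factor; it is positive
   because [a0] is positive at [y] and [z] and not at [x]. *)
pose d := (dotv a0 y - dotv a0 x) / dotv a0 z.
exists (d + m'); apply: (@comb_eq _ _ _ (d + m') _ (d *: z + x)) => //.
  apply: comb_cons; last by apply: comb_sub hx => u /= us; rewrite inE us orbT.
    by rewrite divr_ge0 ?ltW // subr_gt0 (le_lt_trans xle).
  by rewrite /= inE eqxx.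
move/rowP: xy => xy; apply/rowP => i; move: (xy i); rewrite /p /d !mxE; lra.
Qed.

Lemma dotv_row_mx n (x y : 'rV[R]_n) (b c : R) :
  dotv (row_mx x (const_mx b : 'rV_1)) (row_mx y (const_mx c : 'rV_1)) = dotv x y + b * c.
Proof.
rewrite /dotv big_split_ord /= big_ord1 !row_mxEr !mxE; congr (_ + _).
by apply: eq_bigr => i _; rewrite !row_mxEl.
Qed.

(** Appending a coordinate 1 turns affine inequalities into linear ones, so [farkas] applies; the
    same coordinate then shows that the weight of the combination is 1. *)
Lemma comb_hyperplane n (s : seq 'rV[R]_n) (y : 'rV[R]_n) :
  (forall a b, (forall x, x \in s -> dotv a x <= b) -> dotv a y <= b) ->
  comb [set` s] 1 y.
Proof.
move=> h; pose l (x : 'rV[R]_n) := row_mx x (const_mx 1 : 'rV[R]_1).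
have [a ha|m hm] := @farkas _ (map l s) (l y).
  have aE : a = row_mx (lsubmx a) (const_mx (rsubmx a 0 0) : 'rV_1).
    rewrite -{1}[a]hsubmxK; congr row_mx; apply/rowP => i.
    by rewrite !mxE ord1.
  rewrite aE dotv_row_mx mulr1 addrC -lerBrDl sub0r; apply: h => x xs.
  by have := ha _ (map_f l xs); rewrite {1}aE dotv_row_mx mulr1; lra.
have {}hm : exists2 x, comb [set` s] m x & l y = row_mx x (const_mx m : 'rV[R]_1).
  elim: hm => [|c _ {}m u c0 /mapP[v vs ->] _ [x hx ->]].
    by exists 0; [exact: comb_nil | rewrite -row_mx0; congr row_mx; apply/rowP => i; rewrite !mxE].
  exists (c *: v + x); first exact: comb_cons.
  rewrite scale_row_mx add_row_mx; congr row_mx.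
  by apply/rowP => i; rewrite !mxE mulr1.
case: hm => x hx /eq_row_mx[-> /rowP/(_ 0)]; rewrite !mxE => e.
by rewrite e.
Qed.

End Farkas.

(** * Hyperplanes and affine hulls *)

Section Affine.
Variables (R : realType) (n : nat).
Local Notation V := 'rV[R]_n.
Implicit Types (S : set V) (x y t u : V).

Fact dotv_is_linear t : linear (dotv t : V -> R^o).
Proof. by move=> c x y; rewrite dotvDr dotvZr. Qed.

HB.instance Definition _ t :=
  GRing.isLinear.Build R V R^o *:%R (dotv t) (dotv_is_linear t).

Definition perp t : {vspace V} := lker (linfun (dotv t : V -> R^o)).

Lemma mem_perp t u : (u \in perp t) = (dotv t u == 0).
Proof. by rewrite memv_ker lfunE. Qed.

Lemma dim_perp t : (n.-1 <= \dim (perp t))%N.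
Proof.
have := limg_ker_dim (linfun (dotv t : V -> R^o)) fullv.
rewrite capfv dimvf -/(perp t) /dim /= mul1n.
have : (\dim (linfun (dotv t : V -> R^o) @: fullv) <= 1)%N.
  by rewrite -[X in (_ <= X)%N](dimvf R^o) dimvS // subvf.
move=> h e; rewrite -subn1 leq_subLR -[X in (X <= _)%N]e addnC; exact: leq_add.
Qed.

Lemma aff_hull_mem S x : S x -> aff_hull S x.
Proof.
move=> Sx; exists 1%N, (fun=> x), (fun=> 1); split=> //; first by rewrite big_ord1.
by rewrite big_ord1 scale1r.
Qed.

Lemma aff_hull_line S x y c : S x -> S y -> aff_hull S (x + c *: (y - x)).
Proof.
move=> Sx Sy; exists 2%N, (fun i => if i == 0 then x else y), (fun i => if i == 0 then 1 - c else c).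
split; first by move=> i; case: ifP.
  by rewrite !big_ord_recl big_ord0 /= addr0 subrK.
rewrite !big_ord_recl big_ord0 /= addr0.
by apply/rowP => i; rewrite !mxE; ring.
Qed.

Lemma aff_hull_dot_eq S a b x : (forall y, S y -> dotv a y = b) -> aff_hull S x -> dotv a x = b.
Proof.
move=> h [m [y [c [Sy c1 ->]]]]; rewrite dotvC dotv_suml -[b]mul1r -c1 mulr_suml.
by apply: eq_bigr => i _; rewrite dotvZl dotvC h.
Qed.

End Affine.

(** * Faces of a polytope given by generators [Y] and inequalities [T] *)

Section Faces.
Variables (R : realType) (n : nat).
Local Notation V := 'rV[R]_n.
Variables T Y : set V.
Hypotheses (finT : finite_set T) (finY : finite_set Y).
Hypothesis TY : forall x, comb Y 1 x <-> forall t, T t -> dotv t x <= 1.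
Local Notation P := (comb Y 1).

Lemma face_comb a b : (forall x, P x -> dotv a x <= b) ->
  P `&` [set x | dotv a x = b] = comb (Y `&` [set y | dotv a y = b]) 1.
Proof.
move=> h; apply/seteqP; split=> [x [Px /= e]|x hx].
  by apply: comb_face => //; [move=> y Yy; apply: h; exact: comb_mem | rewrite mul1r].
split; first by apply: comb_sub hx => y [].
by rewrite /= -[b]mul1r; apply: comb_dot_eq hx => y [].
Qed.

(** A face is the hull of the generators on its hyperplane, and the subsets of a sequence are
    enumerated by boolean masks. *)
Lemma finite_faces : finite_set (face P).
Proof.
case/finite_seqP: finY => s Ys.
apply: (@sub_finite_set _ _ ((fun m => comb [set` mask m s] 1) @` [set m : (size s).-tuple bool | True])); last exact: finite_image.
move=> F [a [b [h ->]]]; rewrite face_comb // Ys.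
exists (map_tuple (fun x => dotv a x == b) (in_tuple s)) => //.
rewrite /= -filter_mask; congr comb; apply/seteqP; split=> x /=; rewrite mem_filter.
  by move=> /andP[/eqP].
by move=> [-> ->]; rewrite eqxx.
Qed.

(** The centroid of the generators of a face is in its relative interior: an average of numbers at
    most 1 equals 1 only if all of them do. *)
Lemma face_centroid a b : (forall x, P x -> dotv a x <= b) ->
  (exists x, P x /\ dotv a x = b) ->
  exists g, [/\ P g, dotv a g = b & forall t, T t -> dotv t g = 1 ->
    forall y, Y y -> dotv a y = b -> dotv t y = 1].
Proof.
move=> h [x [Px ex]].
have [|y0 [Yy0 /= ey0]] := @comb_exists _ _ (Y `&` [set y | dotv a y = b]) 1 x _ ltr01.
  by rewrite -face_comb.
case/finite_seqP: (sub_finite_set (@subIsetl _ Y [set y | dotv a y = b]) finY) => s hs.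
have y0s : y0 \in s by have : (Y `&` [set y | dotv a y = b]) y0 by []; rewrite hs.
have sY y : y \in s -> Y y /\ dotv a y = b.
  by move=> ys; have : [set` s] y by []; rewrite -hs.
have s0 : 0 < (size s)%:R :> R by rewrite ltr0n; case: s y0s {hs sY}.
pose g := (size s)%:R^-1 *: \sum_(y <- s) y.
have dg t : dotv t g = (size s)%:R^-1 * \sum_(y <- s) dotv t y.
  by rewrite dotvZr dotvC dotv_suml; under eq_bigr do rewrite dotvC.
have sum1 : \sum_(y <- s) 1 = (size s)%:R :> R.
  by rewrite big_const_seq count_predT iter_addr_0.
exists g; split.
- apply: (@comb_eq _ _ _ ((size s)%:R^-1 * \sum_(y <- s) 1) _ g) => //.
    apply: combZ; first by rewrite invr_ge0 ltW.
    by rewrite !big_seq; apply: comb_sum => y /sY[Yy _]; exact: comb_mem.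
  by rewrite sum1 mulVf // gt_eqF.
- rewrite dg (_ : \sum_(y <- s) _ = \sum_(y <- s) 1 * b).
    by rewrite -mulr_suml sum1 mulKf // gt_eqF.
  by apply: eq_big_seq => y /sY[_ ->]; rewrite mul1r.
- move=> t Tt; rewrite dg => e y Yy ey.
  have : \sum_(y <- s) (1 - dotv t y) = 0.
    by rewrite sumrB sum1 -[X in _ - X](mulVKf (lt0r_neq0 s0)) e mulr1 subrr.
  have ys : y \in s by have : (Y `&` [set y | dotv a y = b]) y by []; rewrite hs.
  rewrite big_seq => /eqP; rewrite psumr_eq0 => [|z /sY[Yz _]]; last first.
    by rewrite subr_ge0; move: z Yz => z /comb_mem/TY; exact.
  by move=> /allP/(_ _ ys); rewrite ys /= subr_eq0 => /eqP.
Qed.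

Lemma small_step (s : seq V) (g u : V) :
  (forall t, t \in s -> dotv t g <= 1) ->
  (forall t, t \in s -> dotv t g = 1 -> dotv t u = 0) ->
  exists2 e : R, 0 < e & forall t, t \in s -> dotv t g + e * `|dotv t u| <= 1.
Proof.
elim: s => [|t s IH] h1 h2; first by exists 1.
have [||e e0 he] := IH.
- by move=> v vs; apply: h1; rewrite inE vs orbT.
- by move=> v vs; apply: h2; rewrite inE vs orbT.
have h1t := h1 t (mem_head _ _); have h2t := h2 t (mem_head _ _).
have [d d0 hd] : exists2 d : R, 0 < d & dotv t g + d * `|dotv t u| <= 1.
  have [/h2t ->|tg] := eqVneq (dotv t g) 1; first by exists 1; rewrite // normr0 mulr0 addr0.
  exists ((1 - dotv t g) / (`|dotv t u| + 1)).
    by apply: divr_gt0; [rewrite subr_gt0 lt_neqAle tg | rewrite ltr_wpDl].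
  rewrite -lerBrDl -mulrA ler_piMr ?subr_ge0 // mulrC ler_pdivrMr ?ltr_wpDl //.
  by rewrite mul1r lerDl.
exists (Num.min d e); first by rewrite lt_min d0.
move=> v; rewrite inE => /predU1P[->|vs].
  by apply: le_trans hd; rewrite lerD2l ler_wpM2r // ge_min lexx.
by apply: le_trans (he v vs); rewrite lerD2l ler_wpM2r // ge_min lexx orbT.
Qed.

(** A small step from [g] along [u] or [- u] violates no inequality; [a] can grow in neither
    direction, so it is constant and the step stays in the face. If no inequality is tight at [g],
    [t0] is arbitrary, and [0] gives the whole space. *)
Lemma face_directions a b g (x : V) (U : {vspace V}) t0 :
  let F := P `&` [set x | dotv a x = b] in
  (forall x, P x -> dotv a x <= b) -> F g ->
  (forall t, T t -> dotv t g = 1 -> t = t0) ->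
  aff_hull F = [set x + u | u in [set u | u \in U]] -> (perp t0 <= U)%VS.
Proof.
move=> F h Fg ht0 hU; apply/subvP => u; rewrite mem_perp => /eqP t0u.
have [Pg /= ag] := Fg.
case/finite_seqP: finT => s Ts.
have [t|t|e e0 he] := @small_step s g u.
- by move=> ts; move/TY: Pg; apply; rewrite Ts.
- by move=> ts /ht0 ->; rewrite // Ts.
have Pe c : `|c| = e -> P (g + c *: u).
  move=> ce; apply/TY => t; rewrite Ts => ts; apply: le_trans (he t ts).
  by rewrite dotvDr dotvZr lerD2l -ce -normrM ler_norm.
have au : dotv a u = 0.
  have := h _ (Pe e (gtr0_norm e0)); have := h _ (Pe (- e) _).
  rewrite normrN gtr0_norm // => /(_ erefl); rewrite !dotvDr !dotvZr ag.
  move=> h1 h2; apply/eqP; rewrite eq_le -(pmulr_rle0 _ e0) -(pmulr_rge0 _ e0).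
  by apply/andP; split; lra.
have Fe : F (g + e *: u).
  by split; [apply: Pe; rewrite gtr0_norm | rewrite /= dotvDr dotvZr au mulr0 addr0].
have gu : aff_hull F (g + u).
  have := @aff_hull_line _ _ F _ _ e^-1 Fg Fe.
  by rewrite addrAC subrr add0r scalerA mulVf ?gt_eqF // scale1r.
have := aff_hull_mem Fg; move: gu; rewrite hU => -[u2 /= u2U e2] [u1 /= u1U e1].
have -> : u = u2 - u1 by apply: (addrI g); rewrite -e2 -e1 (addrC u2) addrA addrK.
by rewrite rpredB.
Qed.


Lemma nonempty_has_dim (F : set V) d : has_dim F d -> exists x, F x.
Proof.
move=> [x [U [_ hU]]]; have : aff_hull F x.
  by rewrite hU; exists 0; rewrite /= ?mem0v ?addr0.
move=> [m [y [c [Fy c1 _]]]]; case: m y c Fy c1 => [|m] y c Fy c1.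
  by move: c1; rewrite big_ord0 => /eqP; rewrite eq_sym oner_eq0.
by exists (y ord0).
Qed.

Lemma subset3 (S : set V) a b c : (exists x, S x) -> S `<=` [set a; b; c] ->
  exists a' b' c', S = [set a'; b'; c'].
Proof.
move=> [z Sz] h; pose r x := if `[< S x >] then x else z.
have Sr x : S (r x) by rewrite /r; case: asboolP.
exists (r a), (r b), (r c); apply/seteqP; split=> [x Sx|x [[->|->]|->]] //.
have rx : r x = x by rewrite /r; case: asboolP.
by case: (h x Sx) => [[e|e]|e]; rewrite -e rx; [left; left|left; right|right].
Qed.

(** Two inequalities tight at the centroid of a 2-face are tight on all of it, which leaves at most
    three generators; if at most one is tight, [face_directions] makes the face at least
    3-dimensional. *)
Lemma two_simplicial_comb : n = 4 ->
  (forall t t', T t -> T t' -> t <> t' -> exists a b c, forall y, Y y ->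
    dotv t y = 1 -> dotv t' y = 1 -> [\/ y = a, y = b | y = c]) ->
  two_simplicial P.
Proof.
move=> n4 hT F [[a [b [h FE]]] dF]; split=> //.
have [x Fx] := nonempty_has_dim dF.
have [|g [Pg ag hg]] := face_centroid h; first by exists x; rewrite FE in Fx.
rewrite FE face_comb //.
have [[t [t' [Tt Tt' tt' tg tg']]]|none] := pselect (exists t t',
    [/\ T t, T t', t <> t', dotv t g = 1 & dotv t' g = 1]).
  have [p [q [r hpqr]]] := hT _ _ Tt Tt' tt'.
  have [| |p' [q' [r' ->]]] := @subset3 (Y `&` [set y | dotv a y = b]) p q r.
  - apply: (@comb_exists _ _ _ 1 x) ltr01; rewrite -face_comb // -FE //.
  - move=> y [Yy /= ay]; case: (hpqr y Yy (hg _ Tt tg _ Yy ay) (hg _ Tt' tg' _ Yy ay)) => ->.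
    + by left; left.
    + by left; right.
    + by right.
  - by exists p', q', r'; rewrite conv_hullE.
have [t0 ht0] : exists t0, forall t, T t -> dotv t g = 1 -> t = t0.
  have [[t [Tt tg]]|none'] := pselect (exists t, T t /\ dotv t g = 1).
    exists t => t' Tt' tg'; apply: contra_notP none => tt'.
    by exists t', t.
  by exists 0 => t Tt tg; case: none'; exists t.
case: dF => z [U [dU]]; rewrite FE => hU.
have : (n.-1 <= \dim U)%N.
  apply: leq_trans (dim_perp t0) _; apply: dimvS.
  exact: (@face_directions a b g z U t0 h (conj Pg ag) ht0 hU).
by rewrite dU => n2; move: (n4); lia.
Qed.

(** The inequality [t] tight on a facet is itself the point of tangency: comparing dimensions, the
    directions of the facet are all of [perp t], which contains [t - g], so [t] is in the affine
    hull of the facet; and [t] satisfies all inequalities. *)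
Lemma facet_tangent_comb : (0 < n)%N ->
  (forall t, T t -> dotv t t = 1) -> (forall t t', T t -> T t' -> dotv t t' <= 1) ->
  facet_tangent P.
Proof.
move=> n0 T1 TT F [[a [b [h FE]]] dF].
have [x Fx] := nonempty_has_dim dF.
have [|g [Pg ag hg]] := face_centroid h; first by exists x; rewrite FE in Fx.
case: dF => z [U [dU hU]].
have hp t0 : (forall t, T t -> dotv t g = 1 -> t = t0) -> (perp t0 <= U)%VS.
  by move=> ht0; rewrite FE in hU; exact: (@face_directions a b g z U t0 h (conj Pg ag) ht0 hU).
have [[t [Tt tg]]|none] := pselect (exists t, T t /\ dotv t g = 1); last first.
  have /subvP h0 : (perp 0 <= U)%VS by apply: hp => t Tt tg; case: none; exists t.
  have /dimvS : (fullv <= U)%VS by apply/subvP => u _; apply: h0; rewrite mem_perp dotv0l.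
  by rewrite dimvf dU /dim /= mul1n => le; exfalso; lia.
have Ft y : F y -> dotv t y = 1.
  rewrite FE face_comb // => Fy; rewrite -[RHS]mul1r; apply: comb_dot_eq Fy => v [Yv /= av].
  exact: hg.
have Ut : (U <= perp t)%VS.
  apply/subvP => u uU; rewrite mem_perp.
  have z0 : aff_hull F z by rewrite hU; exists 0; rewrite /= ?mem0v ?addr0.
  have zu : aff_hull F (z + u) by rewrite hU; exists u.
  have := aff_hull_dot_eq Ft zu; rewrite dotvDr (aff_hull_dot_eq Ft z0) => /eqP.
  by rewrite -subr_eq0 addrAC subrr add0r.
have dperp : (\dim (perp t) <= \dim U)%N.
  rewrite dU -ltnS prednK //; have := dimvS (subvf (perp t)).
  rewrite dimvf /dim /= mul1n leq_eqVlt => /predU1P[e|//].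
  have : (perp t == fullv)%VS by rewrite eqEdim subvf dimvf e /dim /= mul1n leqnn.
  by move=> /eqP e'; have := memvf t; rewrite -e' mem_perp T1 // oner_eq0.
have UE : U = perp t by apply/eqP; rewrite eqEdim Ut.
have tF : aff_hull F t.
  have Fg : F g by rewrite FE; split.
  have := aff_hull_mem Fg; rewrite hU => -[u /= uU eu].
  exists (u + (t - g)); last by rewrite addrA eu addrC subrK.
  rewrite /= rpredD // UE mem_perp dotvDr dotvNr T1 // tg subrr //.
exists t; split=> //; first exact: T1.
rewrite FE; split; first by apply/TY => t' Tt'; exact: TT.
by apply: aff_hull_dot_eq tF => y; rewrite FE => -[].
Qed.

End Faces.

(** * Polar pairs with unit normals *)

Section PolarPair.
Variable R : realType.
Local Notation V := 'rV[R]_4.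
Variables T Y : set V.
Hypotheses (finT : finite_set T) (finY : finite_set Y).
Hypothesis T1 : forall t, T t -> dotv t t = 1.
Hypothesis Y0 : comb Y 1 0.
Hypothesis TY1 : forall t y, T t -> Y y -> dotv t y <= 1.
Hypothesis YT : forall x, (forall y, Y y -> dotv y x <= 1) -> comb T 1 x.
Hypothesis T2 : forall t t', T t -> T t' -> t <> t' -> exists a b c, forall y, Y y ->
  dotv t y = 1 -> dotv t' y = 1 -> [\/ y = a, y = b | y = c].
Hypothesis Y2 : forall y y', Y y -> Y y' -> y <> y' -> exists a b c, forall t, T t ->
  dotv y t = 1 -> dotv y' t = 1 -> [\/ t = a, t = b | t = c].
Local Notation E := (comb Y 1).

(** Double polarity: a functional that separates [x] from [Y], suitably scaled, lies in the polar of
    [Y], which is the hull of [T]. *)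
Lemma polar_combY x : E x <-> forall t, T t -> dotv t x <= 1.
Proof.
split=> [Ex t Tt|h].
  by rewrite -[leRHS]mul1r; apply: comb_dot_le Ex => y; exact: TY1.
case/finite_seqP: finY => s Ys; rewrite Ys; apply: comb_hyperplane => a b hab.
have hb y : Y y -> dotv a y <= b by rewrite Ys; exact: hab.
have b0 : 0 <= b by have := comb_dot_le hb Y0; rewrite dotv0r mul1r.
(* The bound [b] may vanish, so the scaling uses a number strictly between [b] and [dotv a x]. *)
rewrite leNgt; apply/negP => bx; pose c := (b + dotv a x) / 2.
have c0 : 0 < c by rewrite /c; lra.
have : comb T 1 (c^-1 *: a).
  apply: YT => y /hb ay; rewrite dotvZr mulrC ler_pdivrMr // mul1r dotvC /c; lra.
move=> hc; have := @comb_dot_le _ _ T 1 _ x 1 _ hc.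
rewrite dotvZr mulrC ler_pdivrMr // mul1r mul1r dotvC => hx.
have : dotv a x <= c by apply: hx => y /h; rewrite dotvC.
rewrite /c; lra.
Qed.

Lemma polar_combT x : comb T 1 x <-> forall y, Y y -> dotv y x <= 1.
Proof.
split=> [Tx y Yy|]; last exact: YT.
by rewrite -[leRHS]mul1r; apply: comb_dot_le Tx => t Tt; rewrite dotvC; exact: TY1.
Qed.

Lemma TT1 t t' : T t -> T t' -> dotv t t' <= 1.
Proof. by move=> /T1 e /T1 e'; have := dotv_le t t'; rewrite e e'; lra. Qed.

Lemma E_ball x : dotv x x <= 1 -> E x.
Proof. by move=> x1; apply/polar_combY => t /T1 t1; have := dotv_le t x; rewrite t1; lra. Qed.

Lemma has_dim_E : has_dim E 4.
Proof.
exists 0, fullv; split; first by rewrite dimvf.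
apply/seteqP; split=> [y _|y _].
  by exists y; rewrite ?add0r //= memvf.
have [->|y0] := eqVneq y 0; first exact: aff_hull_mem.
pose c := Num.sqrt (dotv y y); have c0 : 0 < c by rewrite sqrtr_gt0 dotv_gt0.
have h : E (c^-1 *: y).
  apply: E_ball; rewrite dotvZl dotvZr mulrA -expr2 exprVn sqr_sqrtr ?dotv_ge0 //.
  by rewrite mulVf // dotv_eq0.
have := aff_hull_line c Y0 h.
by rewrite add0r subr0 scalerA mulfV ?gt_eqF // scale1r.
Qed.

Lemma interior_E : interior E 0.
Proof.
(* Four coordinates of absolute value at most 1/2 have squares summing to at most 1. *)
apply/nbhs_ballP; exists 2^-1 => /=; first by rewrite invr_gt0.
move=> y hy; apply: E_ball; rewrite /dotv !big_ord_recl big_ord0.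
have hi i : y 0 i * y 0 i <= 4^-1.
  have := hy.2 0 i; rewrite /ball /= !mxE sub0r normrN => hn.
  rewrite -expr2 -real_normK ?num_real // expr2.
  by have := normr_ge0 (y 0 i); nra.
have h1 := hi ord0; have h2 := hi (lift ord0 ord0); have h3 := hi (lift ord0 (lift ord0 ord0)).
have h4 := hi (lift ord0 (lift ord0 (lift ord0 ord0))).
lra.
Qed.

(** The dual polytope, taken at the origin, is [comb T 1]; as generators and inequalities trade
    places under polarity, [two_simplicial_comb] serves both halves. *)
Lemma polar_pair_good :
  [/\ polytope E, has_dim E 4, two_simple E, two_simplicial E & facet_tangent E].
Proof.
split.
- by exists Y => //; rewrite conv_hullE.
- exact: has_dim_E.
- exists (comb T 1).
    exists 0; first exact: interior_E.
    apply/seteqP; split=> [x /polar_combT h z [y Ey <-]|x h].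
      rewrite subr0 dotvC -[leRHS]mul1r; apply: comb_dot_le Ey => w Yw.
      by rewrite dotvC; exact: h.
    by apply/polar_combT => y Yy; apply: h; exists y; rewrite ?subr0 //; exact: comb_mem.
  exact: (two_simplicial_comb finY finT polar_combT erefl Y2).
- exact: (two_simplicial_comb finT finY polar_combY erefl T2).
- exact: (facet_tangent_comb finT finY polar_combY isT T1 TT1).
Qed.

(** Each unit normal [t i] lies on the face it cuts out, and two unit vectors with product 1 are
    equal, so distinct normals give distinct faces. *)
Lemma many_faces m (t : 'I_m -> V) : injective t -> (forall i, T (t i)) ->
  (m <= #|` fset_set (face E)|)%N.
Proof.
move=> tinj tT; pose F i : set V := E `&` [set x | dotv (t i) x = 1].
have Finj : injective F.
  move=> i j FE; apply: tinj.
  have [_ /= ij] : F j (t i).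
    by rewrite -FE; split; [apply/polar_combY => t' Tt'; exact: TT1 | exact: T1].
  have /eqP : dotv (t j - t i) (t j - t i) = 0.
    by rewrite dotvDl !dotvDr !dotvNl !dotvNr !T1 // (dotvC (t i)) ij; ring.
  by rewrite dotv_eq0 subr_eq0 => /eqP.
have -> : m = #|` seq_fset tt (map F (enum 'I_m))|.
  rewrite size_seq_fset undup_id; first by rewrite size_map size_enum_ord.
  by rewrite (map_inj_uniq Finj) enum_uniq.
apply: fsubset_leq_card; apply/fsubsetP => x; rewrite in_fset_set //; last exact: (finite_faces finY).
rewrite seq_fsetE => /mapP[i _ ->]; apply/mem_set; exists (t i), 1; split=> //.
by move=> y /polar_combY/(_ _ (tT i)).
Qed.

End PolarPair.

(** * Edge-tangent simplicial polytopes *)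

Section Cone.
Variables (R : realType) (n : nat).
Local Notation V := 'rV[R]_n.
Implicit Types (S : set V) (x y : V).

Definition cone S x := exists m, comb S m x.

Lemma cone_mem S c x : 0 <= c -> S x -> cone S (c *: x).
Proof. by move=> c0 /comb_mem hx; exists (c * 1); exact: combZ. Qed.

Lemma coneD S x y : cone S x -> cone S y -> cone S (x + y).
Proof. by move=> [a hx] [b hy]; exists (a + b); exact: combD. Qed.

Lemma coneZ S c x : 0 <= c -> cone S x -> cone S (c *: x).
Proof. by move=> c0 [a hx]; exists (c * a); exact: combZ. Qed.

Lemma cone_sum S (I : finType) (P : pred I) (F : I -> V) :
  (forall i, P i -> cone S (F i)) -> cone S (\sum_(i | P i) F i).
Proof.
move=> h; elim/big_rec: _ => [|i x Pi hx]; first by exists 0; exact: comb_nil.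
by apply: coneD => //; exact: h.
Qed.

Lemma cone_trans S S' x : (forall y, S y -> cone S' y) -> cone S x -> cone S' x.
Proof.
move=> h [m]; elim=> [|c y k z c0 Sy _ IH]; first by exists 0; exact: comb_nil.
by apply: coneD => //; apply: coneZ => //; exact: h.
Qed.

End Cone.

Lemma ord4_split (p q : 'I_4) : p != q -> exists r1 r2 : 'I_4,
  [/\ uniq [:: p; q; r1; r2], forall k, k \in [:: p; q; r1; r2] &
   forall (W : nmodType) (F : 'I_4 -> W), \sum_k F k = F p + F q + F r1 + F r2].
Proof.
move=> pq.
have [s hs] : exists s, perm_eq (enum 'I_4) (p :: q :: s).
  have := perm_to_rem (mem_enum 'I_4 p); have qr : q \in rem p (enum 'I_4).
    by rewrite mem_rem_uniq ?enum_uniq // inE eq_sym pq mem_enum.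
  move=> h; exists (rem q (rem p (enum 'I_4))).
  by rewrite (perm_trans h) // perm_cons perm_to_rem.
have := perm_size hs; rewrite size_enum_ord; case: s hs => [|r1 [|r2 []]] //= hs _.
exists r1, r2; split; first by have := enum_uniq 'I_4; rewrite (perm_uniq hs).
  by move=> k; rewrite -(perm_mem hs) mem_enum.
move=> W F; rewrite -big_enum /= (perm_big _ hs) /= !big_cons big_nil addr0.
by rewrite !addrA.
Qed.

(** Weights none of which exceeds half of the total form the cone over an octahedron. With [q] the
    largest weight and [p] the smallest of the others, four of the six vertices suffice; [e] is the
    coefficient forced on [y r1 + y r2]. *)
Lemma hypersimplex (R : realType) n (y : 'I_4 -> 'rV[R]_n) (m : 'I_4 -> R) :
  (forall k, 0 <= m k) -> (forall k, 2 * m k <= \sum_l m l) ->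
  cone [set z | exists k l, k != l /\ z = y k + y l] (\sum_k m k *: y k).
Proof.
move=> m0 m2.
pose q := [arg max_(k > ord0) m k]%O; have qmax k : m k <= m q.
  by rewrite /q; case: arg_maxP => // i _; apply.
pose p := [arg min_(k < (if q == ord0 then lift ord0 ord0 else ord0) | k != q) m k]%O.
have [pq pmin] : p != q /\ forall k, k != q -> m p <= m k.
  rewrite /p; case: arg_minP => [|i iq h]; last by split.
  by case: (eqVneq q ord0) => [->|] //; rewrite eq_sym.
have [r1 [r2 [u _ sumE]]] := ord4_split pq.
move: u; rewrite /= !inE !negb_or => /and4P[/and3P[_ pr1 pr2] /andP[qr1 qr2] r12 _].
have h1 := pmin r1; have h2 := pmin r2; rewrite eq_sym qr1 eq_sym qr2 in h1 h2.
have {}h1 := h1 isT; have {}h2 := h2 isT.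
have q1 := qmax r1; have q2 := qmax r2.
have := m2 q; rewrite !sumE => Mq.
pose e := (m p + m r1 + m r2 - m q) / 2.
have -> : m p *: y p + m q *: y q + m r1 *: y r1 + m r2 *: y r2 =
  e *: (y r1 + y r2) + m p *: (y p + y q) + (m r1 - e) *: (y q + y r1)
  + (m r2 - e) *: (y q + y r2).
  by apply/rowP => i; rewrite !mxE /e; field.
have mp := m0 p.
do !apply: coneD; apply: cone_mem; rewrite ?/e; try lra.
- by exists r1, r2.
- by exists p, q.
- by exists q, r1.
- by exists q, r2.
Qed.

(** * The hull of an edge-tangent simplicial polytope and its polar *)

Section EdgeTangent.
Variables (R : realType) (J : finType).
Local Notation V := 'rV[R]_4.
Variables (v : J -> 'I_4 -> V) (w : J -> V) (j0 : J).
Implicit Types (x y z u p : V).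

(** The length of the tangents from [u] to the unit sphere. The segment from [u] to [p] touches the
    sphere exactly when [dotv u p = 1 - tlen u * tlen p], and crosses it when the product is
    smaller. *)
Definition tlen u := Num.sqrt (dotv u u - 1).

Hypothesis v_gt1 : forall j k, 1 < dotv (v j k) (v j k).
Hypothesis v_edge : forall j k l, k != l ->
  dotv (v j k) (v j l) = 1 - tlen (v j k) * tlen (v j l).
Hypothesis v_sep : forall j k j' k', v j k = v j' k' \/
  dotv (v j k) (v j' k') <= 1 - tlen (v j k) * tlen (v j' k').
Hypothesis vw1 : forall j k, dotv (v j k) (w j) = 1.
Hypothesis vw_le : forall j k j', dotv (v j k) (w j') <= 1.
Hypothesis vw_eq : forall j k j', dotv (v j k) (w j') = 1 -> exists k', v j k = v j' k'.
Hypothesis nbr : forall j k, exists j', dotv (v j k) (w j') < 1 /\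
  forall l, l != k -> dotv (v j l) (w j') = 1.

Lemma tlen_gt0 j k : 0 < tlen (v j k).
Proof. by rewrite sqrtr_gt0 subr_gt0. Qed.

Lemma dotv_tlen j k : dotv (v j k) (v j k) = 1 + tlen (v j k) * tlen (v j k).
Proof. by rewrite -expr2 sqr_sqrtr ?subr_ge0 ?ltW // addrC subrK. Qed.

Lemma v_inj j : injective (v j).
Proof.
move=> k l e; apply/eqP; apply: contraT => kl; have := v_edge j kl.
rewrite -e dotv_tlen; have := tlen_gt0 j k; nra.
Qed.

(** The differences between the normals of the four neighbours and [w j] form, up to scaling, a dual
    basis: the product matrix is diagonal with negative entries. *)
Lemma facet_basis j z : exists c : 'I_4 -> R, z = \sum_k c k *: v j k.
Proof.
have /choice[nb hnb] : forall k, exists j', dotv (v j k) (w j') < 1 /\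
  forall l, l != k -> dotv (v j l) (w j') = 1 by move=> k; exact: nbr.
pose M : 'M[R]_4 := \matrix_k v j k.
pose N : 'M[R]_4 := \matrix_(i, k) (w (nb k) - w j) 0 i.
have MN : M *m N = diag_mx (\row_k (dotv (v j k) (w (nb k)) - 1)).
  apply/matrixP => i k; rewrite !mxE; under eq_bigr do rewrite !mxE.
  transitivity (dotv (v j i) (w (nb k) - w j)).
    by apply: eq_bigr => l _; rewrite !mxE.
  rewrite dotvDr dotvNr vw1; have [<-|ik] := eqVneq i k; first by rewrite mulr1n.
  by rewrite mulr0n (hnb k).2 // subrr.
have : M *m N \in unitmx.
  rewrite MN unitmxE det_diag unitfE; apply/prodf_neq0 => i _.
  by rewrite mxE subr_eq0 lt_eqF // (hnb i).1.
rewrite unitmx_mul => /andP[uM _].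
exists (fun k => (z *m invmx M) 0 k); rewrite -[LHS](mulmxKV uM) mulmx_sum_row.
by apply: eq_bigr => k _; rewrite rowK.
Qed.

Lemma facet_span j x y : (forall k, dotv (v j k) x = dotv (v j k) y) -> x = y.
Proof.
move=> h; apply: dotv_inj => z; have [c ->] := facet_basis j z.
rewrite !(dotvC _ (\sum_k _)) !dotv_suml; apply: eq_bigr => k _.
by rewrite !dotvZl h.
Qed.

(* At a facet maximizing [dotv z (w j)], comparison with its neighbours puts [z] into
   the cone over the facet; [P] restricts the facets over which one maximizes. *)
Lemma normal_cone (P : pred J) j1 z : P j1 ->
  exists j c, [/\ P j, z = \sum_k c k *: v j k &
   forall k, (forall j', (forall l, l != k -> dotv (v j l) (w j') = 1) -> P j') -> 0 <= c k].
Proof.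
move=> Pj1; pose j := [arg max_(j > j1 | P j) dotv z (w j)]%O.
have [Pj jmax] : P j /\ forall j', P j' -> dotv z (w j') <= dotv z (w j).
  by rewrite /j; case: arg_maxP => // i Pi h; split.
have [c zE] := facet_basis j z; exists j, c; split=> // k hk.
have [j' [kj' lj']] := nbr j k.
have e : dotv z (w j') - dotv z (w j) = c k * (dotv (v j k) (w j') - 1).
  rewrite zE !dotv_suml -sumrB (bigD1 k) //= big1 ?addr0.
    by rewrite !dotvZl vw1 mulr1 mulrBr mulr1.
  by move=> l lk; rewrite !dotvZl vw1 lj' // subrr.
have := jmax j' (hk j' lj'); rewrite -subr_le0 e nmulr_lle0 ?subr_lt0 //.
Qed.

(* The edge touches the sphere where it is divided in the ratio of the tangent lengths. *)
Definition tpt u p := (tlen u + tlen p)^-1 *: (tlen p *: u + tlen u *: p).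

Definition vertices : set V := [set u | exists j k, u = v j k].
Definition tangency : set V := [set t | exists j k l, k != l /\ t = tpt (v j k) (v j l)].
Definition Evertices : set V := vertices `|` [set x | exists j, x = w j].

Lemma tptC u p : tpt u p = tpt p u.
Proof. by rewrite /tpt addrC (addrC (_ *: u)). Qed.

Lemma dotv_tpt x j k l : dotv x (tpt (v j k) (v j l)) =
  (tlen (v j l) * dotv x (v j k) + tlen (v j k) * dotv x (v j l)) / (tlen (v j k) + tlen (v j l)).
Proof. by rewrite dotvZr dotvDr !dotvZr mulrC. Qed.

Lemma tlen_addr_neq0 j k l : tlen (v j k) + tlen (v j l) != 0.
Proof. by rewrite gt_eqF // addr_gt0 // tlen_gt0. Qed.

Lemma dotv_tptl j k l : k != l -> dotv (v j k) (tpt (v j k) (v j l)) = 1.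
Proof.
move=> kl; rewrite dotv_tpt dotv_tlen v_edge //; field.
exact: tlen_addr_neq0.
Qed.

Lemma dotv_tptr j k l : k != l -> dotv (v j l) (tpt (v j k) (v j l)) = 1.
Proof. by move=> kl; rewrite tptC dotv_tptl // eq_sym. Qed.

(** By [v_sep] the numerator falls short of the denominator by at least twice the product of the
    three tangent lengths. *)
Lemma dotv_tpt_lt1 j' k' j k l : v j' k' <> v j k -> v j' k' <> v j l ->
  dotv (v j' k') (tpt (v j k) (v j l)) < 1.
Proof.
move=> n1 n2; rewrite dotv_tpt ltr_pdivrMr ?addr_gt0 ?tlen_gt0 // mul1r.
have s := tlen_gt0 j' k'; have s1 := tlen_gt0 j k; have s2 := tlen_gt0 j l.
case: (v_sep j' k' j k) => // h1; case: (v_sep j' k' j l) => // h2.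
have := mulr_gt0 s1 (mulr_gt0 s s2); nra.
Qed.

Lemma tpt_vertex j' k' j k l : dotv (v j' k') (tpt (v j k) (v j l)) = 1 ->
  v j' k' = v j k \/ v j' k' = v j l.
Proof.
move=> e; apply: contrapT => /not_orP[n1 n2].
by have := dotv_tpt_lt1 n1 n2; rewrite e ltxx.
Qed.

Lemma tpt_normal_le j' j k l : dotv (w j') (tpt (v j k) (v j l)) <= 1.
Proof.
rewrite dotv_tpt ler_pdivrMr ?addr_gt0 ?tlen_gt0 // mul1r !(dotvC (w j')) addrC.
by apply: lerD; rewrite ler_piMr ?vw_le // ltW // tlen_gt0.
Qed.

Lemma tpt_normal j' j k l : dotv (w j') (tpt (v j k) (v j l)) = 1 ->
  dotv (v j k) (w j') = 1 /\ dotv (v j l) (w j') = 1.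
Proof.
rewrite dotv_tpt !(dotvC (w j')) => /divr1_eq.
have s1 := tlen_gt0 j k; have s2 := tlen_gt0 j l.
have h1 := vw_le j k j'; have h2 := vw_le j l j'.
move=> e; have e2 : tlen (v j l) * (1 - dotv (v j k) (w j')) = 0 by nra.
have e1 : tlen (v j k) * (1 - dotv (v j l) (w j')) = 0 by nra.
move/eqP: e1; move/eqP: e2; rewrite !mulf_eq0 (gt_eqF s1) (gt_eqF s2) /= !subr_eq0.
by move=> /eqP <- /eqP <-.
Qed.

Lemma dotv_tpt_tpt j k l : k != l -> dotv (tpt (v j k) (v j l)) (tpt (v j k) (v j l)) = 1.
Proof.
move=> kl; rewrite dotv_tpt !(dotvC (tpt _ _)) dotv_tptl // dotv_tptr //.
by rewrite !mulr1 addrC divff // tlen_addr_neq0.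
Qed.

Definition star u : set V :=
  [set t | exists j k l, [/\ k != l, v j k = u & t = tpt (v j k) (v j l)]].

Lemma star_tangency u : star u `<=` tangency.
Proof. by move=> t [j [k [l [kl _ ->]]]]; exists j, k, l. Qed.

Lemma star_dot u t : star u t -> dotv u t = 1.
Proof. by move=> [j [k [l [kl <- ->]]]]; exact: dotv_tptl. Qed.

(* Maximizing the normals of the facets at [u] in the direction opposite to a
   neighbour shows that the neighbours of [u] surround the line through [u]. *)
Lemma cone_star j k : cone (star (v j k)) (v j k).
Proof.
set u := v j k.
have [l0 kl0] : exists l0, k != l0.
  by exists (if k == ord0 then ord_max else ord0); case: (eqVneq k ord0) => // ->.
have [j1 [c [/eqP uj1 zE c0]]] := @normal_cone (fun j' => dotv u (w j') == 1) j (- v j l0) (introT eqP (vw1 j k)).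
have {uj1}[k1 uE] : exists k1, u = v j1 k1 := vw_eq uj1.
pose S := star u.
have su0 : 0 < tlen u := tlen_gt0 j k.
have nbr_cone i a b d : a != b -> v i a = u -> 0 <= d ->
    exists g m, [/\ comb S m (d *: v i b + g *: u), 0 <= m & (0 < d -> 0 < m)].
  move=> ab iu d0; have sb := tlen_gt0 i b.
  pose m := d * (tlen u + tlen (v i b)) / tlen u.
  have md : 0 <= m by rewrite /m divr_ge0 ?mulr_ge0 ?addr_ge0 // ltW.
  exists (d * tlen (v i b) / tlen u), m; split=> //; last first.
    by move=> dp; rewrite /m divr_gt0 ?mulr_gt0 // addr_gt0.
  have : S (tpt u (v i b)) by exists i, a, b; rewrite iu.
  move=> /comb_mem/(combZ md); rewrite mulr1 => h.
  apply: comb_eq h _ _ => //; apply/rowP => r; rewrite !mxE /m; field.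
  by rewrite !gt_eqF // addr_gt0.
have [g0 [m0 [h0 m0p m0pp]]] := nbr_cone j k l0 1 kl0 erefl ler01.
have [g1 [m1 [h1 m1p]]] : exists g m,
    comb S m (\sum_(b | b != k1) c b *: v j1 b + g *: u) /\ 0 <= m.
  elim/big_rec: _ => [|b x bk1 [g [m [hx mp]]]].
    by exists 0, 0; rewrite scale0r addr0; split=> //; exact: comb_nil.
  have cb : 0 <= c b.
    by apply: c0 => j' hj'; rewrite uE; apply/eqP; apply: hj'; rewrite eq_sym.
  have [|g' [m' [h' mp' _]]] := nbr_cone j1 k1 b (c b) _ (esym uE) cb.
    by rewrite eq_sym.
  exists (g' + g), (m' + m); split; last exact: addr_ge0.
  by apply: comb_eq (combD h' hx) _ _ => //; rewrite scalerDl addrACA.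
(* Adding [v j l0] to its opposite leaves a multiple [g] of [u]; as every point of the star has
   product 1 with [u], [g * dotv u u] is the total weight, so [g] is positive. *)
pose g := g0 + g1 - c k1.
have hg : comb S (m0 + m1) (g *: u).
  apply: comb_eq (combD h0 h1) _ _ => //.
  rewrite (bigD1 k1) //= -uE in zE.
  rewrite /g -[v j l0]opprK zE; set s := \sum_(_ | _) _.
  by apply/rowP => r; rewrite !mxE; ring.
have mp : 0 < m0 + m1 by rewrite ltr_pwDl // m0pp.
have g0' : 0 < g.
  have := comb_dot_eq (@star_dot u) hg; rewrite mulr1 dotvZr => e.
  by move: mp; rewrite -e pmulr_lgt0 // (lt_trans ltr01) // v_gt1.
exists (g^-1 * (m0 + m1)).
have gV : 0 <= g^-1 by rewrite invr_ge0 ltW.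
by apply: comb_eq (combZ gV hg) _ _ => //; rewrite scalerA mulVf ?gt_eqF // scale1r.
Qed.

Lemma comb_normalize (S : set V) x a : (forall t, S t -> dotv a t = 1) ->
  cone S x -> comb S (dotv a x) x.
Proof. by move=> h [m hm]; have := comb_dot_eq h hm; rewrite mulr1 => ->. Qed.

Lemma comb_scale0 (S : set V) m : comb S m 0 -> 0 < m -> comb S 1 0.
Proof.
move=> h m0; have mV : 0 <= m^-1 by rewrite invr_ge0 ltW.
apply: comb_eq (combZ mV h) _ _.
  by rewrite mulVf // gt_eqF.
by rewrite scaler0.
Qed.

(** The opposite of a vertex lies in the cone over some facet, and every vertex is a combination of
    its star by [cone_star]; the sum [0] has positive weight. *)
Lemma tangency_zero : comb tangency 1 0.
Proof.
have [j [c [_ zE c0]]] := @normal_cone predT j0 (- v j0 ord0) isT.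
have comb_v i k : exists2 m, 0 < m & comb tangency m (v i k).
  exists (dotv (v i k) (v i k)); first by rewrite (lt_trans ltr01) // v_gt1.
  by apply: comb_sub (@star_tangency (v i k)) _; apply: comb_normalize (cone_star i k); exact: star_dot.
have [m m0 hm] := comb_v j0 ord0.
have [m' hm'] : cone tangency (\sum_k c k *: v j k).
  apply: cone_sum => k _; apply: coneZ; first exact: c0.
  by have [d _ hd] := comb_v j k; exists d.
apply: (@comb_scale0 _ (m + m')); last by rewrite ltr_pwDl // (comb_ge0 hm').
by apply: comb_eq (combD hm hm') _ _ => //; rewrite -zE subrr.
Qed.

Lemma Evertices_zero : comb Evertices 1 0.
Proof.
have [j [c [_ zE c0]]] := @normal_cone predT j0 (- v j0 ord0) isT.
have pv i k : Evertices (v i k) by left; exists i, k.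
have [m' hm'] : cone Evertices (\sum_k c k *: v j k).
  by apply: cone_sum => k _; apply: cone_mem => //; exact: c0.
apply: (@comb_scale0 _ (1 + m')); last by rewrite ltr_pwDl // (comb_ge0 hm').
by apply: comb_eq (combD (comb_mem (pv j0 ord0)) hm') _ _ => //; rewrite -zE subrr.
Qed.

(** The functional [a] reads off the weight of [x], and the weight missing to 1 is supplied by a
    combination with sum [0]. *)
Lemma comb_fill (S : set V) a x : S `<=` tangency -> (forall t, S t -> dotv a t = 1) ->
  cone S x -> dotv a x <= 1 -> comb tangency 1 x.
Proof.
move=> ST Sa /(comb_normalize Sa)/(comb_sub ST) hx x1.
have x0 : 0 <= 1 - dotv a x by rewrite subr_ge0.
by apply: comb_eq (combD hx (combZ x0 tangency_zero)) _ _; rewrite ?scaler0 ?addr0 // mulr1 addrC subrK.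
Qed.

(* In barycentric coordinates weighted by tangent lengths, the part of the facet
   below its four vertex caps is the hypersimplex; beyond a cap, [cone_star] applies. *)
Lemma polar_Evertices x : (forall y, Evertices y -> dotv y x <= 1) -> comb tangency 1 x.
Proof.
move=> hx; have [j [c [_ xE c0]]] := @normal_cone predT j0 x isT.
have {}c0 k : 0 <= c k by exact: c0.
pose m k := c k * tlen (v j k).
have m0 k : 0 <= m k by rewrite mulr_ge0 // ltW // tlen_gt0.
have cE k : c k *: v j k = m k *: ((tlen (v j k))^-1 *: v j k).
  by rewrite scalerA mulfK // gt_eqF // tlen_gt0.
have pair_tpt k l : k != l -> (tlen (v j k))^-1 *: v j k + (tlen (v j l))^-1 *: v j l =
   ((tlen (v j k))^-1 + (tlen (v j l))^-1) *: tpt (v j k) (v j l).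
  move=> kl; apply/rowP => i; rewrite !mxE; field.
  by rewrite !gt_eqF ?tlen_gt0 // addr_gt0 ?tlen_gt0.
have inv_ge0 k l : 0 <= (tlen (v j k))^-1 + (tlen (v j l))^-1.
  by rewrite addr_ge0 // invr_ge0 ltW // tlen_gt0.
have [ha|/existsNP[k /negP]] := pselect (forall k, 2 * m k <= \sum_l m l).
  pose S : set V := [set t | exists k l, k != l /\ t = tpt (v j k) (v j l)].
  apply: (@comb_fill S (w j)).
  - by move=> t [k [l [kl ->]]]; exists j, k, l.
  - move=> t [k [l [kl ->]]]; rewrite dotv_tpt !(dotvC (w j)) !vw1 !mulr1 addrC.
    by rewrite divff // tlen_addr_neq0.
  - rewrite xE; under eq_bigr do rewrite cE.
    apply: cone_trans (hypersimplex (fun k => (tlen (v j k))^-1 *: v j k) m0 ha) => y [k [l [kl ->]]].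
    by rewrite pair_tpt //; apply: cone_mem => //; exists k, l.
  - by apply: hx; right; exists j.
rewrite -ltNge (bigD1 k) //= mulrDl mul1r ltrD2l => hk.
apply: (@comb_fill (star (v j k)) (v j k)).
- exact: star_tangency.
- exact: star_dot.
(* Each other weight is paired with an equal part of the weight at [k]; the excess stays on the
   vertex and is absorbed by [cone_star]. *)
- have -> : x = (m k - \sum_(l | l != k) m l) *: ((tlen (v j k))^-1 *: v j k) +
      \sum_(l | l != k) m l *: ((tlen (v j k))^-1 *: v j k + (tlen (v j l))^-1 *: v j l).
    under [X in _ + X]eq_bigr do rewrite scalerDr -cE.
    rewrite big_split /= -scaler_suml addrA -scalerDl subrK xE (bigD1 k) //=.
    by rewrite cE.
  apply: coneD.
    rewrite scalerA; apply: coneZ; last exact: cone_star.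
    by rewrite mulr_ge0 ?invr_ge0 ?subr_ge0 ?(ltW hk) // ltW // tlen_gt0.
  apply: cone_sum => l lk; apply: coneZ => //; rewrite pair_tpt 1?eq_sym //.
  by apply: cone_mem => //; exists j, k, l; rewrite eq_sym.
- by apply: hx; left; exists j, k.
Qed.

(** At each vertex of facet [i2] a weighted mean of two numbers at most 1 equals 1, so both are 1,
    and the vertices span. *)
Lemma normal_between i1 i2 i3 (a b : R) : 0 < a -> 0 < b ->
  (a + b) *: w i2 = a *: w i1 + b *: w i3 -> w i1 = w i2.
Proof.
move=> a0 b0 e; apply: (@facet_span i2) => k; rewrite vw1.
have := congr1 (dotv (v i2 k)) e; rewrite dotvDr !dotvZr vw1.
by have := vw_le i2 k i1; have := vw_le i2 k i3; nra.
Qed.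

(** The three normals agree on three of the four basis vectors of facet [i1]; the fourth gives the
    nonnegative parameter [d], so [w i2] and [w i3] lie on one ray from [w i1], and the nearer one
    contradicts [normal_between]. *)
Lemma ridge_normals x y z i1 i2 i3 : vertices x -> vertices y -> vertices z ->
  x <> y -> x <> z -> y <> z ->
  (forall i, i \in [:: i1; i2; i3] -> [/\ dotv x (w i) = 1, dotv y (w i) = 1 & dotv z (w i) = 1]) ->
  w i1 <> w i2 -> w i1 <> w i3 -> w i2 <> w i3 -> False.
Proof.
move=> [jx [kx ->]] [jy [ky ->]] [jz [kz ->]] xy xz yz hi w12 w13 w23.
have [h1x h1y h1z] := hi i1 (mem_head _ _).
have [h2x h2y h2z] : [/\ dotv (v jx kx) (w i2) = 1, dotv (v jy ky) (w i2) = 1 & dotv (v jz kz) (w i2) = 1].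
  by apply: hi; rewrite !inE eqxx orbT.
have [h3x h3y h3z] : [/\ dotv (v jx kx) (w i3) = 1, dotv (v jy ky) (w i3) = 1 & dotv (v jz kz) (w i3) = 1].
  by apply: hi; rewrite !inE eqxx !orbT.
have [k1 ex] := vw_eq h1x; have [k2 ey] := vw_eq h1y; have [k3 ez] := vw_eq h1z.
rewrite ex ey ez in xy xz yz h2x h2y h2z h3x h3y h3z.
have k12 : k1 != k2 by apply/eqP => e; rewrite e in xy.
have k13 : k3 != k1 by apply/eqP => e; rewrite e in xz.
have k23 : k3 != k2 by apply/eqP => e; rewrite e in yz.
have [r hr] : exists r, forall k, [\/ k = k1, k = k2, k = k3 | k = r].
  have [r1 [r2 [_ hk _]]] := ord4_split k12.
  have := hk k3; rewrite !inE (negPf k13) (negPf k23) /= => /orP[]/eqP e3.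
    by exists r2 => k; have := hk k; rewrite !inE -e3 => /or4P[]/eqP ->; [exact: Or41|exact: Or42|exact: Or43|exact: Or44].
  by exists r1 => k; have := hk k; rewrite !inE -e3 => /or4P[]/eqP ->; [exact: Or41|exact: Or42|exact: Or44|exact: Or43].
pose d i := 1 - dotv (v i1 r) (w i).
have d0 i : 0 <= d i by rewrite subr_ge0.
have hd (a b c : R) (i i' : J) : i = i2 \/ i = i3 -> i' = i2 \/ i' = i3 -> c = a + b ->
  c * d i = b * d i' -> c *: w i = a *: w i1 + b *: w i'.
  move=> hi1 hi2 cab cd; apply: (@facet_span i1) => k; rewrite dotvDr !dotvZr vw1.
  case: (hr k) => ->.
  - by case: hi1 => ->; case: hi2 => ->; rewrite ?h2x ?h3x cab; ring.
  - by case: hi1 => ->; case: hi2 => ->; rewrite ?h2y ?h3y cab; ring.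
  - by case: hi1 => ->; case: hi2 => ->; rewrite ?h2z ?h3z cab; ring.
  - by move: cd; rewrite /d cab; nra.
have dp i : w i1 <> w i -> (i = i2 \/ i = i3) -> 0 < d i.
  move=> w1i hi'; rewrite lt_neqAle d0 andbT eq_sym; apply/eqP => di0; apply: w1i.
  have := hd 1 0 1 i i hi' hi'; rewrite di0 !mulr0 addr0 scale0r addr0 !scale1r => h.
  by rewrite h.
have d2 := dp i2 w12 (or_introl erefl); have d3 := dp i3 w13 (or_intror erefl).
have [d23|d32|e23] := ltgtP (d i2) (d i3).
- apply: w12; apply: (@normal_between i1 i2 i3 (d i3 - d i2) (d i2)) => //; first by rewrite subr_gt0.
  by apply: hd => //; [left|right|ring].
- apply: w13; apply: (@normal_between i1 i3 i2 (d i2 - d i3) (d i3)) => //; first by rewrite subr_gt0.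
  by apply: hd => //; [right|left|ring].
- apply: w23; have := hd 0 1 1 i2 i3 (or_introl erefl) (or_intror erefl).
  by rewrite add0r e23 scale0r add0r !scale1r; apply.
Qed.

Lemma ridge_two x y z : vertices x -> vertices y -> vertices z ->
  x <> y -> x <> z -> y <> z ->
  exists w1 w2, forall i, dotv x (w i) = 1 -> dotv y (w i) = 1 -> dotv z (w i) = 1 ->
    w i = w1 \/ w i = w2.
Proof.
move=> vx vy vz xy xz yz.
pose Q i := [/\ dotv x (w i) = 1, dotv y (w i) = 1 & dotv z (w i) = 1].
have [[i1 Q1]|n1] := pselect (exists i, Q i); last first.
  by exists 0, 0 => i hx hy hz; case: n1; exists i.
have [[i2 [Q2 w21]]|n2] := pselect (exists i, Q i /\ w i <> w i1); last first.
  exists (w i1), (w i1) => i hx hy hz; left; apply: contrapT => wi.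
  by apply: n2; exists i.
exists (w i1), (w i2) => i hx hy hz; apply: contrapT => /not_orP[wi1 wi2].
apply: (@ridge_normals x y z i1 i2 i) => //; try exact/nesym.
by move=> k; rewrite !inE => /or3P[]/eqP ->.
Qed.

(** Two different edges have at most one common endpoint and involve at least three vertices,
    through which at most two facet normals pass: one vertex and two normals. *)
Lemma tangency_pair t t' : tangency t -> tangency t' -> t <> t' ->
  exists a b c, forall y, Evertices y -> dotv t y = 1 -> dotv t' y = 1 -> [\/ y = a, y = b | y = c].
Proof.
move=> [j [k [l [kl ->]]]].
suff main j' k' l' : k' != l' -> v j' k' <> v j k -> v j' k' <> v j l ->
    exists a b c, forall y, Evertices y -> dotv (tpt (v j k) (v j l)) y = 1 ->
    dotv (tpt (v j' k') (v j' l')) y = 1 -> [\/ y = a, y = b | y = c].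
  move=> [j' [k' [l' [kl' ->]]]] tt'.
  have [[n1 n2]|h1] := pselect (v j' k' <> v j k /\ v j' k' <> v j l); first exact: main.
  have [[n1 n2]|h2] := pselect (v j' l' <> v j k /\ v j' l' <> v j l).
    by rewrite (tptC (v j' k')); apply: main; rewrite // eq_sym.
  have nn : v j' k' <> v j' l' by move=> /v_inj e; rewrite e eqxx in kl'.
  case: tt'.
  case/not_andP: h1 => /contrapT e1; case/not_andP: h2 => /contrapT e2; rewrite e1 e2 // in nn *.
  by rewrite tptC.
move=> kl' n1 n2.
have [w1 [w2 hw]] : exists w1 w2, forall i, dotv (v j k) (w i) = 1 -> dotv (v j l) (w i) = 1 ->
    dotv (v j' k') (w i) = 1 -> w i = w1 \/ w i = w2.
  apply: ridge_two; try by do 2 eexists.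
  - by move=> /v_inj e; rewrite e eqxx in kl.
  - exact/nesym.
  - exact/nesym.
exists (v j' l'), w1, w2 => y [[i [m ->]]|[i ->]].
  rewrite !(dotvC _ (v i m)) => /tpt_vertex e1 /tpt_vertex e2; apply: Or31.
  by case: e2 => // e2; case: e1 => e1; [case: n1|case: n2]; rewrite -e2.
rewrite !(dotvC _ (w i)) => /tpt_normal[h1 h2] /tpt_normal[h3 _].
by case: (hw i h1 h2 h3) => ->; [exact: Or32|exact: Or33].
Qed.

Lemma ord4_others (k : 'I_4) : exists l1 l2 l3, forall l, l != k -> [\/ l = l1, l = l2 | l = l3].
Proof.
have [q kq] : exists q : 'I_4, k != q.
  by exists (if k == ord0 then ord_max else ord0); case: (eqVneq k ord0) => // ->.
have [r1 [r2 [_ h _]]] := ord4_split kq.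
exists q, r1, r2 => l lk; have := h l; rewrite !inE (negPf lk) /=.
by move=> /or3P[]/eqP ->; [exact: Or31|exact: Or32|exact: Or33].
Qed.

(** Two vertices share at most the edge between them; a vertex and a facet share the three edges at
    that vertex; two facets differ in a vertex, so their common edges are among the three sides of
    the opposite triangle. *)
Lemma Evertices_pair y y' : Evertices y -> Evertices y' -> y <> y' ->
  exists a b c, forall t, tangency t -> dotv y t = 1 -> dotv y' t = 1 -> [\/ t = a, t = b | t = c].
Proof.
have vertex_normal i k j : exists a b c, forall t, tangency t ->
    dotv (v i k) t = 1 -> dotv (w j) t = 1 -> [\/ t = a, t = b | t = c].
  have [/vw_eq[m e]|n] := pselect (dotv (v i k) (w j) = 1); last first.
    exists 0, 0, 0 => t [j' [k' [l' [kl' ->]]]] /tpt_vertex e /tpt_normal[h1 h2].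
    by case: n; case: e => ->.
  have [l1 [l2 [l3 hl]]] := ord4_others m; rewrite e.
  exists (tpt (v j m) (v j l1)), (tpt (v j m) (v j l2)), (tpt (v j m) (v j l3)).
  have goal (p : 'I_4) : p != m -> forall t, t = tpt (v j m) (v j p) ->
     [\/ t = tpt (v j m) (v j l1), t = tpt (v j m) (v j l2) | t = tpt (v j m) (v j l3)].
    by move=> /hl[] -> t ->; [exact: Or31|exact: Or32|exact: Or33].
  move=> t [j' [k' [l' [kl' ->]]]] /tpt_vertex e' /tpt_normal[/vw_eq[p ep] /vw_eq[q eq]].
  have pq : p != q by apply: contraNneq kl' => pq; apply/eqP/(@v_inj j'); rewrite ep eq pq.
  rewrite ep eq in e' *; case: e' => /v_inj em; rewrite -em in pq *.
    by apply: (goal q); rewrite // eq_sym.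
  by apply: (goal p); rewrite // tptC.
have swap y1 y2 : (exists a b c, forall t, tangency t ->
    dotv y1 t = 1 -> dotv y2 t = 1 -> [\/ t = a, t = b | t = c]) ->
    exists a b c, forall t, tangency t ->
    dotv y2 t = 1 -> dotv y1 t = 1 -> [\/ t = a, t = b | t = c].
  by move=> [a [b [c h]]]; exists a, b, c => t Tt h1 h2; exact: h.
move=> [[i [k ->]]|[i ->]] [[j [l ->]]|[j ->]] ne; [| |apply: swap|] => //; last first.
  have [k nk] : exists k, dotv (v i k) (w j) <> 1.
    apply: contrapT => /forallNP h; apply: ne; apply: (@facet_span i) => k.
    by rewrite vw1; apply/esym; exact: contrapT.
  have [l1 [l2 [l3 hl]]] := ord4_others k.
  exists (tpt (v i l1) (v i l2)), (tpt (v i l1) (v i l3)), (tpt (v i l2) (v i l3)).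
  move=> t [j' [k' [l' [kl' ->]]]] /tpt_normal[/vw_eq[p ep] /vw_eq[q eq]] /tpt_normal[h1 h2].
  have pq : p != q by apply: contraNneq kl' => pq; apply/eqP/(@v_inj j'); rewrite ep eq pq.
  rewrite ep eq in h1 h2 *.
  have pk : p != k by apply/eqP => e; rewrite e in h1.
  have qk : q != k by apply/eqP => e; rewrite e in h2.
  case: (hl _ pk) pq => ->; case: (hl _ qk) => -> //; rewrite ?eqxx // => _;
    do ?[exact: Or31 | exact: Or32 | exact: Or33]; rewrite tptC;
    do ?[exact: Or31 | exact: Or32 | exact: Or33].
exists (tpt (v i k) (v j l)), (tpt (v i k) (v j l)), (tpt (v i k) (v j l)).
move=> t [j' [k' [l' [kl' ->]]]] /tpt_vertex e1 /tpt_vertex e2; apply: Or31.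
by move: ne; case: e1 => ->; case: e2 => -> // _; rewrite tptC.
Qed.

Lemma finite_tangency : finite_set tangency.
Proof.
apply: (@sub_finite_set _ _ ((fun x : J * 'I_4 * 'I_4 => tpt (v x.1.1 x.1.2) (v x.1.1 x.2)) @` setT)).
  by move=> t [j [k [l [_ ->]]]]; exists (j, k, l).
by apply: finite_image; exact: finite_finset.
Qed.

Lemma finite_Evertices : finite_set Evertices.
Proof.
rewrite finite_setU; split.
  apply: (@sub_finite_set _ _ ((fun x : J * 'I_4 => v x.1 x.2) @` setT)).
    by move=> t [j [k ->]]; exists (j, k).
  by apply: finite_image; exact: finite_finset.
apply: (@sub_finite_set _ _ (w @` setT)); first by move=> t [j ->]; exists j.
by apply: finite_image; exact: finite_finset.
Qed.

Lemma tangency_unit t : tangency t -> dotv t t = 1.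
Proof. by move=> [j [k [l [kl ->]]]]; exact: dotv_tpt_tpt. Qed.

Lemma tangency_Evertices t y : tangency t -> Evertices y -> dotv t y <= 1.
Proof.
move=> [j [k [l [kl ->]]]] [[i [m ->]]|[i ->]]; last by rewrite dotvC; exact: tpt_normal_le.
rewrite dotvC; have [->|n1] := pselect (v i m = v j k); first by rewrite dotv_tptl.
have [->|n2] := pselect (v i m = v j l); first by rewrite dotv_tptr.
exact/ltW/dotv_tpt_lt1.
Qed.

Definition Epolytope := comb Evertices 1.

Lemma Epolytope_good : [/\ polytope Epolytope, has_dim Epolytope 4, two_simple Epolytope,
  two_simplicial Epolytope & facet_tangent Epolytope].
Proof.
exact: (polar_pair_good finite_tangency finite_Evertices tangency_unit Evertices_zero tangency_Evertices
  polar_Evertices tangency_pair Evertices_pair).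
Qed.

Lemma Epolytope_finite_faces : finite_set (face Epolytope).
Proof. exact: (finite_faces finite_Evertices). Qed.

Lemma Epolytope_many_faces m (t : 'I_m -> V) : injective t -> (forall i, tangency (t i)) ->
  (m <= #|` fset_set (face Epolytope)|)%N.
Proof.
exact: (many_faces finite_Evertices tangency_unit Evertices_zero tangency_Evertices polar_Evertices).
Qed.

End EdgeTangent.

(** * Chains of 600-cells *)

Section Eval.
Variable R : realType.

Definition phi : R := (1 + Num.sqrt 5) / 2.
Definition rho : R := Num.sqrt (2 + phi).
Definition zr (z : Z) : R := (int_of_Z z)%:~R.
Definition ev (a : zphi) : R := zr a.1 + zr a.2 * phi.

Lemma phi_sq : phi * phi = phi + 1.
Proof.
have h : Num.sqrt 5 * Num.sqrt 5 = 5 :> R by rewrite -expr2 sqr_sqrtr // ler0n.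
by rewrite /phi; move: h; set s := Num.sqrt 5 => h; lra.
Qed.

Lemma phi_bounds : 55 / 34 < phi < 34 / 21.
Proof.
have h := phi_sq; have p0 : 0 <= phi by rewrite divr_ge0 // addr_ge0 // sqrtr_ge0.
by apply/andP; split; nra.
Qed.

Lemma rho_sq : rho * rho = 2 + phi.
Proof. by have := phi_bounds; rewrite -expr2 => /andP[h _]; rewrite sqr_sqrtr //; lra. Qed.

Lemma rho_gt0 : 0 < rho.
Proof. by have := phi_bounds => /andP[h _]; rewrite sqrtr_gt0; lra. Qed.

Lemma zrD a b : zr (Z.add a b) = zr a + zr b.
Proof. by rewrite /zr (rmorphD int_of_Z a b) intrD. Qed.

Lemma zrM a b : zr (Z.mul a b) = zr a * zr b.
Proof. by rewrite /zr (rmorphM int_of_Z a b) intrM. Qed.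

Lemma zrN a : zr (Z.opp a) = - zr a.
Proof. by rewrite /zr (rmorphN int_of_Z a) intrN. Qed.

Lemma zr_le0 a : Z.leb a Z0 -> zr a <= 0.
Proof. by rewrite /zr lerz0; case: a. Qed.

Lemma zr_lt0 a : Z.ltb a Z0 -> zr a < 0.
Proof. by rewrite /zr ltrz0; case: a. Qed.

Lemma evD a b : ev (zadd a b) = ev a + ev b.
Proof. by rewrite /ev /= !zrD; ring. Qed.

Lemma evN a : ev (zopp a) = - ev a.
Proof. by rewrite /ev /= !zrN; ring. Qed.

Lemma evB a b : ev (zsub a b) = ev a - ev b.
Proof. by rewrite evD evN. Qed.

Lemma evM a b : ev (zmul a b) = ev a * ev b.
Proof.
rewrite /ev /= !zrD !zrM zrD; transitivity (zr a.1 * zr b.1 + zr a.1 * zr b.2 * phi +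
  zr a.2 * zr b.1 * phi + zr a.2 * zr b.2 * (phi + 1)); first by ring.
by rewrite -phi_sq; ring.
Qed.

Lemma ev_int a b : ev (a, b) = zr a + zr b * phi. Proof. by []. Qed.

Lemma zr_nat n : zr (Z.of_nat n) = n%:R.
Proof. by rewrite /zr; case: n => //= n; rewrite Pnat.SuccNat2Pos.id_succ. Qed.

(** Interpolation between consecutive Fibonacci quotients, where [34 * 34 - 21 * 55 = 1]; both outer
    factors are positive, so signs can be read off from integers. *)
Lemma ev_interp a : ev a = (34 * phi - 55) * (21 * zr a.1 + 34 * zr a.2) +
  (34 - 21 * phi) * (34 * zr a.1 + 55 * zr a.2).
Proof. by rewrite /ev; ring. Qed.

Lemma ev_bounds (a : zphi) : [/\ 0 < 34 * phi - 55, 0 < 34 - 21 * phi,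
  zr (Z.add (Z.mul 34 a.1) (Z.mul 55 a.2)) = 34 * zr a.1 + 55 * zr a.2 &
  zr (Z.add (Z.mul 21 a.1) (Z.mul 34 a.2)) = 21 * zr a.1 + 34 * zr a.2].
Proof.
have /andP[b1 b2] := phi_bounds.
split; [lra | lra | |].
  by rewrite zrD !zrM (zr_nat 34) (zr_nat 55).
by rewrite zrD !zrM (zr_nat 34) (zr_nat 21).
Qed.

Lemma ev_le0 a : zle0 a -> ev a <= 0.
Proof.
have [b1 b2 e1 e2] := ev_bounds a.
move=> /andP[/zr_le0 + /zr_le0]; rewrite e1 e2 ev_interp => h1 h2.
by rewrite -[0]addr0; apply: lerD; rewrite pmulr_rle0.
Qed.

Lemma ev_lt0 a : zlt0 a -> ev a < 0.
Proof.
have [b1 b2 e1 e2] := ev_bounds a.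
move=> /andP[/zr_lt0 + /zr_lt0]; rewrite e1 e2 ev_interp => h1 h2.
by rewrite -[0]addr0; apply: ltrD; rewrite pmulr_rlt0.
Qed.

Definition rvec := (R * R * R * R * R)%type.
Implicit Types X Y : rvec.

Definition raxis X Y : R :=
  let: (_, _, _, d, e) := X in let: (_, _, _, d', e') := Y in d * d' - (2 + phi) * (e * e').
Definition rform X Y : R :=
  let: (a, b, c, _, _) := X in let: (a', b', c', _, _) := Y in
  a * a' + (b * b' + c * c') + raxis X Y.
Definition rboost X : rvec :=
  let: (a, b, c, d, e) := X in
  (a, b, c, (3 + 2 * phi) * d + (2 + 6 * phi) * e, 2 * phi * d + (3 + 2 * phi) * e).
Definition height X : R := X.2.

Definition evv (X : zvec) : rvec :=
  let: (a, b, c, d, e) := X in (ev a, ev b, ev c, ev d, ev e).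

Lemma ev_axis (X Y : zvec) : ev (zaxis X Y) = raxis (evv X) (evv Y).
Proof.
by case: X Y => [[[[a b] c] d] e] [[[[a' b'] c'] d'] e']; rewrite /= evB !evM /ev /zr /= mul1r.
Qed.

Lemma ev_form (X Y : zvec) : ev (zform X Y) = rform (evv X) (evv Y).
Proof.
have := ev_axis X Y; case: X Y => [[[[a b] c] d] e] [[[[a' b'] c'] d'] e'] h.
by rewrite /zform evD h !evD !evM.
Qed.

Lemma evv_boost (X : zvec) : evv (zboost X) = rboost (evv X).
Proof.
case: X => [[[[a b] c] d] e]; rewrite /= !evD !evM !ev_int.
by rewrite (zr_nat 0) (zr_nat 2) (zr_nat 3) (zr_nat 6) add0r.
Qed.

Lemma rformC X Y : rform X Y = rform Y X.
Proof. by case: X Y => [[[[a b] c] d] e] [[[[a' b'] c'] d'] e'] /=; ring. Qed.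

Lemma rform_boost X Y : rform (rboost X) (rboost Y) = rform X Y.
Proof.
case: X Y => [[[[a b] c] d] e] [[[[a' b'] c'] d'] e'] /=.
have := phi_sq; move: phi => p /eqP; rewrite -subr_eq0 => /eqP hp.
apply/eqP; rewrite -subr_eq0; apply/eqP.
(* The difference of the two sides is divided explicitly by the minimal polynomial of [phi]. *)
transitivity ((p * p - (p + 1)) * (- 4 * (p + 2) * (d * d') -
  2 * (3 + 2 * p) * (d * e' + e * d') - 4 * (p - 3) * (e * e'))); first by ring.
by rewrite hp mul0r.
Qed.

(* Cayley-Hamilton for the boost, whose determinant is 1. *)
Lemma raxis_boost2 X Y :
  raxis X (rboost (rboost Y)) = 2 * (3 + 2 * phi) * raxis X (rboost Y) - raxis X Y.
Proof.
case: X Y => [[[[a b] c] d] e] [[[[a' b'] c'] d'] e'] /=.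
have := phi_sq; move: phi => p /eqP; rewrite -subr_eq0 => /eqP hp.
apply/eqP; rewrite -subr_eq0; apply/eqP.
transitivity ((p * p - (p + 1)) * (8 * (d * d' - (2 + p) * (e * e')))); first by ring.
by rewrite hp mul0r.
Qed.

Lemma rform_iter i d X Y :
  rform (iter i rboost X) (iter (i + d) rboost Y) = rform X (iter d rboost Y).
Proof. by elim: i => // i IH; rewrite addSn !iterS rform_boost. Qed.

Section Decay.
Variables X Y : rvec.
Hypothesis h1 : raxis X (rboost Y) <= 0.
Hypothesis h2 : raxis X (rboost (rboost Y)) <= raxis X (rboost Y).

(** The factor [2 * (3 + 2 * phi)] of the recurrence exceeds 2, so a sequence that is nonpositive
    and has started to decrease keeps decreasing. *)
Lemma raxis_decay d : raxis X (iter d.+1 rboost Y) <= 0 /\ raxis X (iter d.+2 rboost Y) <= raxis X (iter d.+1 rboost Y).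
Proof.
elim: d => [|d [IH1 IH2]]; first by [].
split; first exact: le_trans IH2 IH1.
rewrite [X in raxis _ X <= _]iterS [X in raxis _ (rboost X) <= _]iterS raxis_boost2.
rewrite -[rboost (iter d.+1 rboost Y)]iterS.
have /andP[b1 b2] := phi_bounds.
move: IH1 IH2; set u := raxis X (iter d.+1 _ _); set w := raxis X (iter d.+2 _ _) => u0 wu.
have : (2 * (3 + 2 * phi) - 2) * w <= 0 by apply: mulr_ge0_le0; lra.
lra.
Qed.

Lemma raxis_decay_le d : raxis X (iter d.+1 rboost Y) <= raxis X (rboost Y).
Proof. by elim: d => // d IH; apply: le_trans (raxis_decay d).2 IH. Qed.

(** Boosts fix the first three coordinates, whose share of the form cancels. *)
Lemma rform_sub d d' : rform X (iter d rboost Y) - rform X (iter d' rboost Y) =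
  raxis X (iter d rboost Y) - raxis X (iter d' rboost Y).
Proof.
have fst_iter k : (iter k rboost Y).1.1 = Y.1.1.
  by elim: k => // k; rewrite iterS; case: (iter k _ _) => [[[[a b] c] u] v].
have rformE Z : rform X Z = X.1.1.1.1 * Z.1.1.1.1 + (X.1.1.1.2 * Z.1.1.1.2 + X.1.1.2 * Z.1.1.2)
    + raxis X Z.
  by case: X Z => [[[[a b] c] u] v] [[[[a' b'] c'] u'] v'].
by rewrite !rformE !fst_iter; ring.
Qed.

Lemma rform_decay d : rform X (iter d.+1 rboost Y) <= rform X (rboost Y).
Proof. by rewrite -subr_le0 (rform_sub d.+1 1) subr_le0 raxis_decay_le. Qed.

Lemma rform_decay2 d : rform X (iter d.+2 rboost Y) <= rform X (rboost (rboost Y)).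
Proof.
rewrite -subr_le0 (rform_sub d.+2 2) subr_le0.
by elim: d => // d IH; apply: le_trans (raxis_decay d.+1).2 IH.
Qed.

End Decay.

End Eval.

(** * From homogeneous coordinates to points of the affine chart *)

Section Points.
Variable R : realType.
Local Notation rvec := (rvec R).
Local Notation phi := (phi R).
Local Notation rho := (rho R).
Implicit Types X Y : rvec.

(** The factor [rho] shrinks the sphere of squared radius [2 + phi] to the unit sphere. *)
Definition pt X : 'rV[R]_4 :=
  (rho * height X)^-1 *: \row_(i < 4) nth 0 [:: X.1.1.1.1; X.1.1.1.2; X.1.1.2; X.1.2] i.

(** At positive heights the comparison of a product with 1 is thus the sign of the Lorentz form,
    which boosts preserve. *)
Lemma dotv_pt X Y : height X != 0 -> height Y != 0 ->
  dotv (pt X) (pt Y) = 1 + rform X Y / ((2 + phi) * height X * height Y).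
Proof.
move=> hX hY; rewrite dotvZl dotvZr /dotv !big_ord_recl big_ord0 !mxE /= -rho_sq.
have r0 := rho_gt0 R; move: hX hY.
case: X Y => [[[[a b] c] d] e] [[[[a' b'] c'] d'] e']; rewrite /height /= -rho_sq => e0 e0'.
by field; rewrite e0 e0' gt_eqF.
Qed.

Lemma tlen_pt X : 0 < height X -> rform X X = 2 - phi -> tlen (pt X) = (phi - 1) / (rho * height X).
Proof.
move=> hX fX; rewrite /tlen dotv_pt ?gt_eqF // fX addrAC subrr add0r.
have /andP[b1 b2] := phi_bounds R; have r0 := rho_gt0 R.
have -> : (2 - phi) / ((2 + phi) * height X * height X) = ((phi - 1) / (rho * height X)) ^+ 2.
  rewrite exprMn exprVn !expr2 mulrACA rho_sq mulrA; congr (_ / _).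
  by have := phi_sq R; lra.
rewrite sqrtr_sqr ger0_norm // divr_ge0 //; first by lra.
by rewrite mulr_ge0 // ltW.
Qed.

Lemma dotv_pt_le X Y c : 0 < height X -> 0 < height Y -> rform X Y <= c ->
  dotv (pt X) (pt Y) <= 1 + c / ((2 + phi) * height X * height Y).
Proof.
move=> hX hY h; rewrite dotv_pt ?gt_eqF // lerD2l ler_wpM2r // invr_ge0.
by rewrite -rho_sq !mulr_ge0 // ltW // rho_gt0.
Qed.

Lemma dotv_pt_lt1 X Y : 0 < height X -> 0 < height Y -> rform X Y < 0 -> dotv (pt X) (pt Y) < 1.
Proof.
move=> hX hY h; rewrite dotv_pt ?gt_eqF // gtrDl pmulr_llt0 // invr_gt0.
by rewrite -rho_sq !mulr_gt0 // rho_gt0.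
Qed.

Lemma dotv_pt_eq1 X Y : 0 < height X -> 0 < height Y ->
  (dotv (pt X) (pt Y) == 1) = (rform X Y == 0).
Proof.
move=> hX hY; rewrite dotv_pt ?lt0r_neq0 // -[X in _ == X]addr0 (inj_eq (addrI 1)).
have h : 0 < (2 + phi) * height X * height Y; last by rewrite mulf_eq0 invr_eq0 orbC gt_eqF.
by rewrite -rho_sq !mulr_gt0 // rho_gt0.
Qed.

End Points.

(** * The chain as an edge-tangent polytope *)

Section Chain.
Variables (R : realType) (verts : seq zvec) (facets : seq (seq zvec)) (n : nat).
Hypothesis facets_tet : forall f, f \in facets -> tetrahedron verts f.
Hypothesis facets_height : forall f, f \in facets -> upward (south \in f) (facet_normal f).
Hypothesis verts_height : forall X, X \in verts -> upward (X == south) X.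
Hypothesis verts_pair : forall X Y, X \in verts -> Y \in verts -> vertex_pair X Y.
Hypothesis facets_vertex : forall f X, f \in facets -> X \in verts ->
  facet_vertex f (facet_normal f) X.
Hypothesis facets_neighbour : forall f k, f \in facets -> (k < 4)%N -> exists g, [/\ g \in facets,
  shares f g k, zlt0 (zform (nth south f k) (facet_normal g)),
  south \in g -> south \notin f -> exists g', [/\ g' \in facets, south \notin g', north \notin g',
    shares (map zboost f) g' k & zlt0 (zform (zboost (nth south f k)) (facet_normal g'))] &
  north \in g -> north \notin f -> exists g', [/\ g' \in facets, south \notin g', north \notin g',
    shares f (map zboost g') k & zlt0 (zform (nth south f k) (zboost (facet_normal g')))]].
Hypothesis free : exists2 f, f \in facets & free_edge f.

Local Notation phi := (phi R).

Definition copy i (X : zvec) : rvec R := iter i (@rboost R) (evv R X).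

Lemma copyS i X : copy i.+1 X = copy i (zboost X).
Proof. by rewrite /copy iterSr evv_boost. Qed.

Lemma rform_copy i d X Y : rform (copy i X) (copy (i + d) Y) = rform (evv R X) (copy d Y).
Proof. exact: rform_iter. Qed.

Lemma rform_copy0 i X Y : rform (copy i X) (copy i Y) = ev R (zform X Y).
Proof. by rewrite -{2}[i]addn0 rform_copy ev_form. Qed.

Lemma rform_copy1 i X Y : rform (copy i X) (copy i.+1 Y) = ev R (zform X (zboost Y)).
Proof. by rewrite -addn1 rform_copy ev_form evv_boost. Qed.

Lemma decaying_copy X Y : decaying X (zboost Y) (zboost (zboost Y)) ->
  (forall i d, rform (copy i X) (copy (i + d.+1) Y) <= ev R (zform X (zboost Y))) /\
  (forall i d, rform (copy i X) (copy (i + d.+2) Y) <= ev R (zform X (zboost (zboost Y)))).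
Proof.
move=> /andP[/(@ev_le0 R)]; rewrite ev_axis !evv_boost => h1.
move=> /(@ev_le0 R); rewrite evB !ev_axis !evv_boost subr_le0 => h2.
split=> i d; rewrite rform_copy ev_form !evv_boost; first exact: rform_decay.
exact: rform_decay2.
Qed.

Lemma raxis_centre X : raxis (evv R centre) X = - (2 + phi) * height X.
Proof.
case: X => [[[[a b] c] d] e]; rewrite /= !ev_int (zr_nat R 0) (zr_nat R 1) /height /=.
by ring.
Qed.

(** A single boost gives the south pole the negative height [3 - 2 * phi], hence the restriction by
    [b]. The height is a negative multiple of the form with [centre], to which the decay applies. *)
Lemma height_gt0 b i X : upward b X -> (b -> i = 0%N) -> 0 < height (copy i X).
Proof.
have hpos Y : raxis (evv R centre) Y < 0 -> 0 < height Y.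
  by rewrite raxis_centre mulNr oppr_lt0 -rho_sq pmulr_rgt0 // mulr_gt0 // rho_gt0.
rewrite /upward; case: ifP => // h0; case: i => [|i].
  by move=> _ _; apply: hpos; rewrite -ev_axis; exact: ev_lt0.
case: b => [_ /(_ isT)//|] /andP[h1 /andP[/(@ev_le0 R) h2 /(@ev_le0 R) h3]] _.
rewrite evB !ev_axis !evv_boost subr_le0 in h3; rewrite ev_axis !evv_boost in h2.
apply: hpos; apply: le_lt_trans (raxis_decay_le h2 h3 i) _.
by rewrite -evv_boost -ev_axis; exact: ev_lt0.
Qed.

(* The facets at a pole are present only at the corresponding end of the chain. *)
Definition allowed (i : nat) (f : seq zvec) := ((south \in f) ==> (i == 0%N)) && ((north \in f) ==> (i == n)).

Definition chain_index : Type :=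
  {x : 'I_n.+1 * 'I_(size facets) | allowed x.1 (nth [::] facets x.2)}.

Definition place (x : chain_index) : nat := (val x).1.
Definition cell (x : chain_index) : seq zvec := nth [::] facets (val x).2.

Lemma cell_facets x : cell x \in facets. Proof. by apply: mem_nth; exact: ltn_ord. Qed.

Lemma place_le x : (place x <= n)%N. Proof. by rewrite -ltnS; exact: ltn_ord. Qed.

Lemma south_place x : south \in cell x -> place x = 0%N.
Proof. by move=> h; have := valP x; rewrite -/(cell x) /allowed h => /andP[/eqP]. Qed.

Lemma north_place x : north \in cell x -> place x = n.
Proof. by move=> h; have := valP x; rewrite -/(cell x) /allowed h => /andP[_ /eqP]. Qed.

Lemma index_exists i f : (i <= n)%N -> f \in facets -> allowed i f ->
  exists x, place x = i /\ cell x = f.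
Proof.
move=> ile ff a; have fi : (index f facets < size facets)%N by rewrite index_mem.
have h : allowed (Ordinal (ile : (i < n.+1)%N)) (nth [::] facets (Ordinal fi)) by rewrite /= nth_index.
by exists (exist _ (Ordinal (ile : (i < n.+1)%N), Ordinal fi) h); split=> //; rewrite /cell /= nth_index.
Qed.

Lemma index_inner i f : (i <= n)%N -> f \in facets -> south \notin f -> north \notin f ->
  exists x, place x = i /\ cell x = f.
Proof. by move=> ile ff /negPf sf /negPf nf; apply: index_exists; rewrite // /allowed sf nf. Qed.

Definition okv i X := [/\ X \in verts, (i <= n)%N, X = south -> i = 0%N & X = north -> i = n].

Lemma cell_size x : size (cell x) = 4%N.
Proof. by have /and3P[/eqP] := facets_tet (cell_facets x). Qed.

Lemma cell_verts x X : X \in cell x -> X \in verts.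
Proof. by have /and3P[_ /allP h _] := facets_tet (cell_facets x); exact: h. Qed.

Lemma mem_cell x (k : 'I_4) : nth south (cell x) k \in cell x.
Proof. by rewrite mem_nth // cell_size. Qed.

Lemma okv_cell x X : X \in cell x -> okv (place x) X.
Proof.
move=> h; split; [exact: cell_verts h|exact: place_le|move=> e|move=> e].
  by apply: south_place; rewrite -e.
by apply: north_place; rewrite -e.
Qed.

Lemma okv_height i X : okv i X -> 0 < height (copy i X).
Proof. by case=> Xv _ sX _; apply: height_gt0 (verts_height Xv) _ => /eqP. Qed.

Lemma normal_height x : 0 < height (copy (place x) (facet_normal (cell x))).
Proof. exact: height_gt0 (facets_height (cell_facets x)) (@south_place x). Qed.

(** Distances 0, 1 and 2 between blocks are covered by the check, larger ones by the decay from 2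
    on. Vertices of different blocks coincide only at distance 1, where blocks are glued. *)
Lemma copy_apart i j X Y : okv i X -> okv j Y ->
  copy i X = copy j Y \/ rform (copy i X) (copy j Y) <= - (2 - phi).
Proof.
wlog ij : i j X Y / (i <= j)%N.
  move=> h hX hY; have [ij|/ltnW ji] := leqP i j; first exact: h.
  by rewrite rformC; case: (h _ _ _ _ ji hY hX) => [->|]; [left|right].
move=> [Xv ile sX nX] [Yv jle sY nY]; have := verts_pair Xv Yv.
have ev2 a : zle0 (zadd a (2, -1)%ZZ) -> ev R a <= - (2 - phi).
  move=> /(@ev_le0 R); rewrite evD ev_int (zr_nat R 2) (_ : zr R (-1)%ZZ = -1); first by lra.
  by rewrite (zrN R 1%ZZ) (zr_nat R 1).
rewrite /vertex_pair; case: ifP => // h0.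
have [e _|lt_ij] := eqVneq i j.
  move: h0; rewrite e => /orP[/eqP ->|/ev2 h]; [by left|right].
  by rewrite rform_copy0.
have {}lt_ij : (i < j)%N by rewrite ltn_neqAle lt_ij.
case: ifP => [/orP[/eqP/nX e|/eqP/sY e]|_]; [lia|lia|].
move=> /and3P[h1 h2 /decaying_copy[d1 d2]].
case: (posnP (j - i.+1)) => ji.
  have -> : j = i.+1 by lia.
  case/orP: h1 => [/eqP ->|/ev2 h1]; first by left; rewrite copyS.
  by right; rewrite rform_copy1.
right; have -> : j = (i + (j - i.+2).+2)%N by lia.
exact: le_trans (d2 _ _) (ev2 _ h2).
Qed.

(** This is the convexity of the chain, split by whether the vertex precedes, shares or follows the
    block of the facet; a product 0 across blocks occurs only at distance 1, for a glued vertex of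
    the facet. *)
Lemma copy_normal i X x : okv i X ->
  rform (copy i X) (copy (place x) (facet_normal (cell x))) <= 0 /\
  (rform (copy i X) (copy (place x) (facet_normal (cell x))) = 0 ->
   exists k : 'I_4, copy i X = copy (place x) (nth south (cell x) k)).
Proof.
move=> [Xv ile sX nX]; have := facets_vertex (cell_facets x) Xv.
have nthk Y : Y \in cell x -> exists k : 'I_4, Y = nth south (cell x) k.
  move=> Yc; have hk : (index Y (cell x) < 4)%N by rewrite -(cell_size x) index_mem.
  by exists (Ordinal hk); rewrite /= nth_index.
have zero Y : Y \in cell x -> ev R (zform Y (facet_normal (cell x))) = 0.
  move=> Yc; have := facets_vertex (cell_facets x) (cell_verts Yc).
  rewrite /facet_vertex Yc; case: ifP => // /eqP -> _.
  by rewrite ev_int (zr_nat R 0); ring.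
have neg (r : R) (Q : Prop) : r < 0 -> r <= 0 /\ (r = 0 -> Q).
  by move=> r0; split; [exact: ltW|move=> e; rewrite e ltxx in r0].
rewrite /facet_vertex; case: ifP => // h0; case: ifP => // h1 h2.
have [lt|gt|e] := ssrnat.ltngtP i (place x); last first.
- rewrite e rform_copy0; move: h0; case: ifP => [Xc _|_ /ev_lt0 h]; last exact: neg.
  by rewrite zero //; split=> // _; have [k ->] := nthk X Xc; exists k.
- move: h1; case: ifP => [/orP[/north_place e2|/eqP/sX e2]|_]; [lia|lia|].
  move=> /and3P[h3 h4 /decaying_copy[d1 d2]]; rewrite rformC.
  case: (posnP (i - (place x).+1)) => ji.
    have -> : i = (place x).+1 by lia.
    rewrite rform_copy1; case/orP: h3 => [Yc|/ev_lt0 h3]; last exact: neg.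
    rewrite ev_form rformC -ev_form zero //; split=> // _.
    by have [k hk] := nthk _ Yc; exists k; rewrite copyS hk.
  have -> : i = (place x + (i - (place x).+2).+2)%N by lia.
  by apply: neg; exact: le_lt_trans (d2 _ _) (ev_lt0 _ h4).
- have le := place_le x; move: h2; case: ifP => [/orP[/south_place e2|/eqP/nX e2]|_]; [lia|lia|].
  move=> /and3P[h3 h4 /decaying_copy[d1 d2]].
  case: (posnP (place x - i.+1)) => ji.
    have -> : place x = i.+1 by lia.
    rewrite rform_copy1; case/orP: h3 => [/mapP[Y Yc ->]|/ev_lt0 h3]; last exact: neg.
    rewrite ev_form !evv_boost rform_boost -ev_form zero //; split=> // _.
    by have [k ->] := nthk Y Yc; exists k; rewrite -copyS.
  have -> : place x = (i + (place x - i.+2).+2)%N by lia.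
  by apply: neg; exact: le_lt_trans (d2 _ _) (ev_lt0 _ h4).
Qed.

Definition cvert (x : chain_index) (k : 'I_4) : 'rV[R]_4 := pt (copy (place x) (nth south (cell x) k)).
Definition cnormal (x : chain_index) : 'rV[R]_4 := pt (copy (place x) (facet_normal (cell x))).


Lemma vertex_height x (k : 'I_4) : 0 < height (copy (place x) (nth south (cell x) k)).
Proof. by apply: okv_height; apply: okv_cell; exact: mem_cell. Qed.

Lemma rform_cell x (k l : 'I_4) :
  rform (copy (place x) (nth south (cell x) k)) (copy (place x) (nth south (cell x) l)) =
  if k == l then 2 - phi else - (2 - phi).
Proof.
have /and3P[_ _ /allP h] := facets_tet (cell_facets x).
have := h k; rewrite mem_iota => /(_ (ltn_ord k)) /allP/(_ l); rewrite mem_iota => /(_ (ltn_ord l)) /eqP.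
rewrite rform_copy0 => ->; rewrite -val_eqE /=.
by case: ifP => _; rewrite ev_int ?(zrN R 1%ZZ) ?(zrN R 2%ZZ) (zr_nat R 1) (zr_nat R 2); ring.
Qed.

Lemma sub_phi_gt0 : 0 < 2 - phi.
Proof. by have /andP[b1 b2] := phi_bounds R; lra. Qed.

Lemma tlen_cvert x k : tlen (cvert x k) = (phi - 1) / (rho R * height (copy (place x) (nth south (cell x) k))).
Proof. by rewrite tlen_pt ?vertex_height // rform_cell eqxx. Qed.

(* [phi - 1] is the inverse of phi, so its square is [2 - phi]. *)
Lemma tlen_mul x k y l : tlen (cvert x k) * tlen (cvert y l) = (2 - phi) /
  ((2 + phi) * height (copy (place x) (nth south (cell x) k)) * height (copy (place y) (nth south (cell y) l))).
Proof.
rewrite !tlen_cvert -rho_sq; have h1 := vertex_height x k; have h2 := vertex_height y l.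
have -> : 2 - phi = (phi - 1) * (phi - 1) by have := phi_sq R; lra.
by field; rewrite !gt_eqF ?rho_gt0.
Qed.

Lemma cvert_gt1 x k : 1 < dotv (cvert x k) (cvert x k).
Proof.
have h := vertex_height x k; rewrite dotv_pt ?gt_eqF // ltrDl rform_cell eqxx.
by rewrite divr_gt0 ?sub_phi_gt0 // -rho_sq !mulr_gt0 // rho_gt0.
Qed.

Lemma cvert_edge x k l : k != l ->
  dotv (cvert x k) (cvert x l) = 1 - tlen (cvert x k) * tlen (cvert x l).
Proof.
move=> /negPf kl; rewrite tlen_mul dotv_pt ?lt0r_neq0 ?vertex_height // rform_cell kl.
by rewrite mulNr.
Qed.

Lemma cvert_sep x k y l : cvert x k = cvert y l \/
  dotv (cvert x k) (cvert y l) <= 1 - tlen (cvert x k) * tlen (cvert y l).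
Proof.
case: (copy_apart (okv_cell (mem_cell x k)) (okv_cell (mem_cell y l))) => h.
  by left; rewrite /cvert h.
by right; rewrite tlen_mul -mulNr; apply: dotv_pt_le; rewrite ?vertex_height.
Qed.

Lemma rform_member x X : X \in cell x ->
  rform (copy (place x) X) (copy (place x) (facet_normal (cell x))) = 0.
Proof.
move=> Xc; have := facets_vertex (cell_facets x) (cell_verts Xc).
rewrite rform_copy0 /facet_vertex Xc; case: ifP => // /eqP -> _.
by rewrite ev_int (zr_nat R 0); ring.
Qed.

Lemma cvert_normal1 x k : dotv (cvert x k) (cnormal x) = 1.
Proof.
apply/eqP; rewrite dotv_pt_eq1 ?vertex_height ?normal_height //.
by rewrite rform_member ?mem_cell.
Qed.

Lemma cvert_normal_le x k y : dotv (cvert x k) (cnormal y) <= 1.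
Proof.
have [h _] := copy_normal y (okv_cell (mem_cell x k)).
have := dotv_pt_le (vertex_height x k) (normal_height y) h.
by rewrite mul0r addr0.
Qed.

Lemma cvert_normal_eq x k y : dotv (cvert x k) (cnormal y) = 1 -> exists l, cvert x k = cvert y l.
Proof.
move=> /eqP; rewrite dotv_pt_eq1 ?vertex_height ?normal_height // => /eqP.
have [_ h] := copy_normal y (okv_cell (mem_cell x k)) => /h[l e].
by exists l; rewrite /cvert e.
Qed.

(** The neighbour [g] within the 600-cell serves unless it has a pole that the chain lacks at this
    place; then the facet across the glueing icosahedron, one place before or after, replaces it. *)
Lemma cvert_neighbour x k : exists y, dotv (cvert x k) (cnormal y) < 1 /\
  forall l, l != k -> dotv (cvert x l) (cnormal y) = 1.
Proof.
have [g [gf sh lt sg ng]] := facets_neighbour (cell_facets x) (ltn_ord k).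
have sharesP f f' : shares f f' k -> forall l : 'I_4, l != k -> nth south f l \in f'.
  rewrite /shares lallE => /allP h l lk; have := h l; rewrite mem_iota => /(_ (ltn_ord l)).
  by rewrite (_ : (l == k :> nat) = false) //; apply/negbTE; rewrite -val_eqE in lk.
have concl y : rform (copy (place x) (nth south (cell x) k)) (copy (place y) (facet_normal (cell y))) < 0 ->
   (forall l : 'I_4, l != k -> exists2 Y, Y \in cell y &
      copy (place x) (nth south (cell x) l) = copy (place y) Y) ->
   exists y, dotv (cvert x k) (cnormal y) < 1 /\
     forall l, l != k -> dotv (cvert x l) (cnormal y) = 1.
  move=> h1 h2; exists y; split; first by apply: dotv_pt_lt1; rewrite ?vertex_height ?normal_height.
  move=> l lk; have [Y Yc e] := h2 l lk; apply/eqP.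
  by rewrite dotv_pt_eq1 ?vertex_height ?normal_height // e rform_member.
have [/andP[gs px]|nB] := boolP ((south \in g) && (0 < place x)%N).
  have sx : south \notin cell x by apply/negP => /south_place e; rewrite e in px.
  have [g' [g'f sg' ng' sh' lt']] := sg gs sx.
  have [|y [py cy]] := @index_inner (place x).-1 g' _ g'f sg' ng'.
    exact: leq_trans (leq_pred _) (place_le x).
  have ex : place x = (place y).+1 by rewrite py prednK.
  apply: (concl y); first by rewrite ex copyS cy rform_copy0; exact: ev_lt0.
  move=> l lk; exists (zboost (nth south (cell x) l)); last by rewrite ex copyS.
  have := sharesP _ _ sh' l lk; rewrite (nth_map south) ?cell_size //.
  by rewrite cy.
have [/andP[gn px]|nC] := boolP ((north \in g) && (place x < n)%N).
  have nx : north \notin cell x by apply/negP => /north_place e; rewrite e ltnn in px.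
  have [g' [g'f sg' ng' sh' lt']] := ng gn nx.
  have [y [py cy]] := @index_inner (place x).+1 g' px g'f sg' ng'.
  apply: (concl y); first by rewrite py cy rform_copy1; exact: ev_lt0.
  move=> l lk; have /mapP[Y Yg e] := sharesP _ _ sh' l lk.
  by exists Y; rewrite ?cy // e py copyS.
have [|y [py cy]] := @index_exists (place x) g (place_le x) gf.
  apply/andP; split; apply/implyP => gX.
    by move: nB; rewrite gX /= -leqNgt leqn0.
  by move: nC; rewrite gX /= -leqNgt eqn_leq place_le.
apply: (concl y); first by rewrite py cy rform_copy0; exact: ev_lt0.
by move=> l lk; exists (nth south (cell x) l); rewrite ?py // cy; exact: sharesP.
Qed.

(** Each block contributes its copy of one edge. If two tangency points agreed, an endpoint of the
    later edge would, by [tpt_vertex], be an endpoint of the earlier one. *)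
Lemma chain_tangencies : exists t : 'I_n.+1 -> 'rV[R]_4,
  injective t /\ forall i, tangency cvert (t i).
Proof.
have [f ff /and4P[sf nf h0 h1]] := free.
have /choice[x hx] : forall i : 'I_n.+1, exists x, place x = i /\ cell x = f.
  by move=> i; apply: index_inner => //; rewrite -ltnS; exact: ltn_ord.
pose a : 'I_4 := ord0; pose b : 'I_4 := lift ord0 ord0.
exists (fun i => tpt (cvert (x i) a) (cvert (x i) b)); split; last first.
  by move=> i; exists (x i), a, b.
suff lt_neq (i j : 'I_n.+1) : (i < j)%N ->
    tpt (cvert (x i) a) (cvert (x i) b) <> tpt (cvert (x j) a) (cvert (x j) b).
  move=> i j e; case: (ssrnat.ltngtP i j) => [/lt_neq|/lt_neq|/val_inj] //.
  by move=> h; case: h.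
move=> ij e.
have := dotv_tptl cvert_gt1 cvert_edge (x j) (isT : a != b).
rewrite -e => /(tpt_vertex cvert_gt1 cvert_sep).
have neg (c : 'I_4) : zlt0 (zform (nth south f c) (zboost (nth south f 0))) ->
    cvert (x j) a <> cvert (x i) c.
  (* Equal vertices would have a product above 1, whereas the decay keeps the form negative at every
     distance [j - i]. *)
  move=> hc ec; have := cvert_gt1 (x i) c; rewrite -{2}ec ltNge => /negP; apply.
  apply: ltW; apply: dotv_pt_lt1; rewrite ?vertex_height //.
  have [Xc Xa] := (mem_cell (x i) c, mem_cell (x j) a).
  have := verts_pair (cell_verts Xc) (cell_verts Xa).
  rewrite (hx i).1 (hx i).2 (hx j).1 (hx j).2 /= in Xc Xa *.
  rewrite /vertex_pair; case: ifP => // _; case: ifP => [/orP[/eqP E|/eqP E]|_].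
  - by rewrite E (negPf nf) in Xc.
  - by rewrite E (negPf sf) in Xa.
  move=> /and3P[_ _ /decaying_copy[d1 _]]; have -> : (j : nat) = (i + (j - i.+1).+1)%N by lia.
  exact: le_lt_trans (d1 _ _) (ev_lt0 _ hc).
by case=> ec; [exact: (neg a h0 ec)|exact: (neg b h1 ec)].
Qed.

Lemma chain_good : exists E : set 'rV[R]_4,
  [/\ [/\ polytope E, has_dim E 4, two_simple E, two_simplicial E & facet_tangent E],
      finite_set (face E) & (n < #|` fset_set (face E)|)%N].
Proof.
have [f ff /and4P[sf nf _ _]] := free; have [x0 _] := index_inner (leq0n n) ff sf nf.
exists (Epolytope cvert cnormal); split.
- exact: (Epolytope_good x0 cvert_gt1 cvert_edge cvert_sep cvert_normal1 cvert_normal_le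
    cvert_normal_eq cvert_neighbour).
- exact: Epolytope_finite_faces.
- have [t [tinj tT]] := chain_tangencies.
  exact: (Epolytope_many_faces x0 cvert_gt1 cvert_edge cvert_sep cvert_normal1 cvert_normal_le
    cvert_normal_eq cvert_neighbour tinj tT).
Qed.

End Chain.

Lemma chain_polytope (R : realType) (n : nat) : exists E : set 'rV[R]_4,
  [/\ [/\ polytope E, has_dim E 4, two_simple E, two_simplicial E & facet_tangent E],
      finite_set (face E) & (n < #|` fset_set (face E)|)%N].
Proof.
pose facets := orbit_facets reduced_facets.
apply: (@chain_good R vertices600 facets n).
- exact: (facets_tetrahedron zsyms_act_check tetrahedron_check).
- exact: (facets_height normal_height_check).
- exact: (verts_height vertex_height_check).
- exact: (verts_pair vertex_pair_check).
- exact: (facets_vertex zsyms_act_check facet_vertex_check).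
- exact: (facets_neighbour neighbour_check).
- by apply/hasP; rewrite -lhasE; exact: free_edge_check.
Qed.

(** * Infinitely many face lattices, told apart by their size *)

Lemma face_lattice_iso_card (R : realType) n (P Q : set 'rV[R]_n) :
  finite_set (face P) -> face_lattice_iso P Q ->
  #|` fset_set (face P)| = #|` fset_set (face Q)|.
Proof.
move=> /finite_setP[m Pm] [f [fb _]].
have PQ : (face P #= face Q)%card by apply/card_set_bijP; exists f.
by rewrite (card_fset_set Pm) (card_fset_set (card_eq_trans (card_esym PQ) Pm)).
Qed.

Theorem theorem11 (R : realType) :
  exists A : set (set 'rV[R]_4),
    [/\ infinite_set A,
        (forall E, A E ->
           [/\ polytope E, has_dim E 4, two_simple E, two_simplicial E
             & facet_tangent E])
      & (forall E E', A E -> A E' -> E <> E' -> ~ face_lattice_iso E E')].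
Proof.
have /choice[E hE] := chain_polytope R.
pose c n := #|` fset_set (face (E n))|.
(* Each index is the face count of the previous polytope; as [E n] has more than [n] faces, the
   counts increase strictly along [m]. *)
pose m k := iter k c 0%N.
have c_mono : {homo (fun k => c (m k)) : k l / (k < l)%N}.
  by apply: homo_ltn => [y x z|k]; [exact: ltn_trans|have [_ _ h] := hE (m k.+1); exact: h].
have c_inj k l : c (m k) = c (m l) -> k = l.
  by move=> e; case: (ssrnat.ltngtP k l) => // /c_mono; rewrite e ltnn.
exists (range (fun k => E (m k))); split.
- move=> fin; apply: infinite_nat.
  rewrite (_ : [set: nat] = (fun k => E (m k)) @^-1` range (fun k => E (m k))); last first.
    by apply/seteqP; split=> // k _; exists k.
  apply: finite_preimage fin => k l _ _ e; apply: c_inj.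
  by rewrite /c e.
- by move=> _ [k _ <-]; have [] := hE (m k).
- move=> _ _ [k _ <-] [l _ <-] ne iso; apply: ne.
  have [_ fin _] := hE (m k).
  by have := face_lattice_iso_card fin iso => /c_inj ->.
Qed.
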